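(* Let $K$ be a field. The following assertions are equivalent: (1) For any integer $n\ge1$ and any monomial ideal $I\subset S=K[x_1,\ldots,x_n]$, one has $\operatorname{sdepth}_S(S/I)\ge\operatorname{depth}_S(S/I)$. (2) For any integer $n\ge1$ and any monomial ideals $I,J\subset S=K[x_1,\ldots,x_n]$: if $\operatorname{sdepth}_S(S/(I\cap J))\ge\operatorname{depth}_S(S/(I\cap J))$, then $\operatorname{sdepth}_S(S/I)\ge\operatorname{depth}_S(S/I)$. (3) For any integers $n,m\ge1$ and any monomial ideal $I\subset S=K[x_1,\ldots,x_n]$, if $u_1,\ldots,u_m\in S$ are monomials forming a regular sequence on $S/I$ and $J=(u_1,\ldots,u_m)$, then $$\operatorname{sdepth}_S(S/(I\cap J))\ge\operatorname{depth}_S(S/(I\cap J))\ \Rightarrow\ \operatorname{sdepth}_S(S/I)\ge\operatorname{depth}_S(S/I).$$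
   Context: Let $S=K[x_1,\ldots,x_n]$ with its $\mathbb Z^n$-grading, and let $M\neq 0$ be a finitely generated $\mathbb Z^n$-graded $S$-module. A Stanley decomposition of $M$ is a finite direct sum decomposition of $K$-vector spaces $\mathcal D: M=\bigoplus_{i=1}^t m_iK[Z_i]$, where the $m_i\in M$ are homogeneous, $Z_i\subset\{x_1,\ldots,x_n\}$, and each $m_iK[Z_i]$ is a free $K[Z_i]$-module. Put $\operatorname{sdepth}(\mathcal D)=\min_i|Z_i|$, and let $\operatorname{sdepth}_S(M)$ be the maximum of $\operatorname{sdepth}(\mathcal D)$ over all Stanley decompositions of $M$. The depth $\operatorname{depth}_S(M)$ is taken with respect to the ideal $(x_1,\ldots,x_n)$. Both invariants are considered only for nonzero modules; monomial ideals in the assertions are nonzero and proper. *)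

(* Defs.v *)
From HB Require Import structures.
From mathcomp Require Import all_boot all_order all_algebra.
From mathcomp Require Import ring_quotient mpoly.
From Stdlib Require Import ClassicalEpsilon.

Set Implicit Arguments.
Unset Strict Implicit.
Unset Printing Implicit Defensive.

Import GRing.Theory.
Local Open Scope ring_scope.
Local Open Scope quotient_scope.

(* Unspecified when P is empty or unbounded. *)
Definition max_nat (P : nat -> Prop) : nat :=
  epsilon (inhabits 0%N) (fun k => P k /\ forall l, P l -> (l <= k)%N).

Section Ideals.
Variable R : comNzRingType.

Definition ideal_gen (A : R -> Prop) (f : R) : Prop :=
  exists s : seq (R * R),
    (forall p, p \in s -> A p.2) /\ f = \sum_(p <- s) p.1 * p.2.

(* [idealr R] only contains proper ideals; membership is boolean, which is no
   restriction classically. *)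
Definition ideal_cap (I J : idealr R) : {pred R} :=
  fun f => (f \in I) && (f \in J).

Lemma ideal_cap_closed (I J : idealr R) : idealr_closed (ideal_cap I J).
Proof.
rewrite /ideal_cap; split=> [||a u v]; rewrite [_ \in _]unfold_in.
- by rewrite !idealr0.
- by rewrite idealr1.
move=> /andP[uI uJ] /andP[vI vJ]; rewrite [_ \in _]unfold_in.
by rewrite !rpredD ?idealMr.
Qed.

HB.instance Definition _ (I J : idealr R) :=
  isIdealr.Build R (ideal_cap I J) (ideal_cap_closed I J).

End Ideals.

(* R/I as an R-module; an alias, so as not to interfere with other module
   structures on the quotient ring. *)
Definition quot_mod (R : comNzRingType) (I : idealr R) : Type :=
  {ideal_quot I}.

Section QuotientModule.
Variables (R : comNzRingType) (I : idealr R).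

HB.instance Definition _ := GRing.Zmodule.on (quot_mod I).

Definition quot_pi (f : R) : quot_mod I := \pi_({ideal_quot I}) f.

Definition quot_scale (a : R) (x : quot_mod I) : quot_mod I :=
  (quot_pi a : {ideal_quot I}) * (x : {ideal_quot I}).

Lemma quot_scaleA a b x :
  quot_scale a (quot_scale b x) = quot_scale (a * b) x.
Proof. by rewrite /quot_scale /quot_pi rmorphM mulrA. Qed.

Lemma quot_scale1 : left_id 1 quot_scale.
Proof. by move=> x; rewrite /quot_scale /quot_pi rmorph1 mul1r. Qed.

Lemma quot_scaleDr : right_distributive quot_scale +%R.
Proof. by move=> a x y; rewrite /quot_scale mulrDr. Qed.

Lemma quot_scaleDl x : {morph quot_scale^~ x : a b / a + b}.
Proof. by move=> a b; rewrite /quot_scale /quot_pi rmorphD mulrDl. Qed.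

HB.instance Definition _ := GRing.Zmodule_isLmodule.Build R (quot_mod I)
  quot_scaleA quot_scale1 quot_scaleDr quot_scaleDl.

Lemma quot_piM (a f : R) : quot_pi (a * f) = a *: quot_pi f.
Proof. exact: rmorphM. Qed.

End QuotientModule.

Section RegularSequences.
Variables (R : comNzRingType) (M : lmodType R).

(* The submodule (u_1, ..., u_k) M. *)
Definition mul_submod (us : seq R) (x : M) : Prop :=
  exists s : seq (R * M),
    (forall p, p \in s -> p.1 \in us) /\ x = \sum_(p <- s) p.1 *: p.2.

Definition regular_seq (us : seq R) : Prop :=
  (forall i, (i < size us)%N -> forall x : M,
     mul_submod (take i us) (us`_i *: x) -> mul_submod (take i us) x)
  /\ (exists x : M, ~ mul_submod us x).

End RegularSequences.

Section Invariants.
Variables (K : fieldType) (n : nat).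
Local Notation S := {mpoly K[n]}.

Definition is_monomial (u : S) : Prop := exists a : 'X_{1..n}, u = 'X_[a].

Definition monomial_ideal (I : idealr S) : Prop :=
  exists A : S -> Prop,
    (forall u, A u -> is_monomial u) /\ (forall f, f \in I <-> ideal_gen A f).

Definition nonzero_ideal (I : idealr S) : Prop := exists2 f, f \in I & f != 0.

Definition irrelevant_ideal : S -> Prop :=
  ideal_gen (fun u => exists i : 'I_n, u = 'X_i).

Definition depth (M : lmodType S) : nat :=
  max_nat (fun k => exists us : seq S,
    [/\ size us = k, forall u, u \in us -> irrelevant_ideal u
      & regular_seq M us]).

(* The polynomial subring K[Z]. *)
Definition subpoly (Z : {set 'I_n}) (f : S) : Prop :=
  forall a, a \in msupp f -> forall i, a i != 0%N -> i \in Z.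

Section Stanley.
(* [gr a] is the graded component of M in degree a. *)
Variables (M : lmodType S) (gr : {ffun 'I_n -> int} -> M -> Prop).

Definition homogeneous (x : M) : Prop := exists a, gr a x.

(* m K[Z] *)
Definition stanley_space (m : M) (Z : {set 'I_n}) (x : M) : Prop :=
  exists2 f, subpoly Z f & x = f *: m.

(* The cyclic module m K[Z] is required to be free on its generator m, so
   zero summands are excluded. *)
Definition stanley_decomposition (t : nat) (m : 'I_t -> M)
    (Z : 'I_t -> {set 'I_n}) : Prop :=
  [/\ forall i, homogeneous (m i),
      forall i f, subpoly (Z i) f -> f *: m i = 0 -> f = 0
    & forall x, exists! v : {ffun 'I_t -> M},
        (forall i, stanley_space (m i) (Z i) (v i)) /\ x = \sum_i v i].

(* As #|Z i| <= n, the default value n only matters for the empty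
   decomposition, which occurs for M = 0 only. *)
Definition sdepth_decomposition (t : nat) (Z : 'I_t -> {set 'I_n}) : nat :=
  \big[minn/n]_(i < t) #|Z i|.

Definition sdepth : nat :=
  max_nat (fun k => exists (t : nat) (m : 'I_t -> M) (Z : 'I_t -> {set 'I_n}),
    stanley_decomposition m Z /\ sdepth_decomposition Z = k).

End Stanley.

(* The Z^n-grading of S/I (for I monomial) induced by that of S. *)
Definition quot_grading (I : idealr S) (a : {ffun 'I_n -> int})
    (x : quot_mod I) : Prop :=
  exists2 f : S, (forall b, b \in msupp f -> forall i, (b i)%:Z = a i)
               & x = quot_pi I f.

Definition depth_quot (I : idealr S) : nat := depth (quot_mod I).

Definition sdepth_quot (I : idealr S) : nat := sdepth (@quot_grading I).

End Invariants.

(* Main.v *)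
From HB Require Import structures.
Require Import Defs.
From mathcomp Require Import all_boot all_order all_algebra.
From mathcomp Require Import ring_quotient mpoly.
From mathcomp Require Import zify ring.
From Stdlib Require Import ClassicalEpsilon.

Set Implicit Arguments.
Unset Strict Implicit.
Unset Printing Implicit Defensive.

Import GRing.Theory.
Local Open Scope ring_scope.

(** Each assertion has the conclusion of the first one under more hypotheses, and
    the third is a special case of the second.  The content is the passage from
    [assertion3] to [assertion1].

    Let I be a monomial ideal of S = K[x_1..x_n].  Adjoin variables y_1..y_m and
    put S' = S[y_1..y_m], I' = I S' and J = (y_1..y_m), which is generated by a
    regular sequence on S'/I'.  For m large the premise of [assertion3]
    holds for I' and J because n separates the two invariants:
    [depth S'/(I' :&: J) <= n <= sdepth S'/(I' :&: J)].  Then [assertion3] gives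
    [depth S'/I' <= sdepth S'/I'], and m new variables raise the depth by at
    least m ([depth_ext_ge]) and the Stanley depth by at most m
    ([sdepth_ext_le]), whence the inequality for I.

    Upper bound on the depth ([depth_ext_cap_le]).  If x^a lies in I, the
    annihilator of the class of x^a is J, and S'/J is a polynomial ring in n
    variables.  The depth is at most n by the following argument.  A regular
    sequence u is quasi-regular ([quasi_regular], by induction on its length and
    on the degree).  More than n elements of u satisfy a polynomial relation F
    modulo J, by a dimension count ([algebraic_dependence]), so F(u) kills x^a.
    Comparing lowest forms, quasi-regularity puts x^a into every power of the
    ideal (u), modulo I' :&: J ([annihilated_in_powers]); as (u) lies in the
    irrelevant ideal, the degree of x^a makes this impossible.

    Lower bound on the Stanley depth ([sdepth_ext_cap_ge]).  Homogeneous elements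
    of a quotient by a monomial ideal are multiples of monomials, so a Stanley
    decomposition is a partition of the monomials outside the ideal into finitely
    many cells x^a K[Z].  The monomials outside I' :&: J are those of K[x], which
    form one cell with n free variables, and the x^a y^b with x^a outside I and
    b nonzero.  The exponents a are cut at a bound beyond which membership in I
    does not change ([up_closed_truncate], a form of Dickson's lemma), and the
    supports of the b are distributed over a partition of the nonempty subsets of
    the y-variables into intervals whose upper ends have at least n elements.
    Such interval partitions exist for large m, by tripling the ground set
    ([interval_partition_triple]). *)

(** * Ideals as predicates *)

Section IdealPredicates.
Variable R : comNzRingType.

(** Ideals that need neither be proper nor decidable, such as those
    generated by a regular sequence together with a given ideal. *)
Definition ideal_like (A : R -> Prop) :=
  A 0 /\ forall a x y, A x -> A y -> A (a * x + y).

Variable A : R -> Prop.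

Lemma ideal_gen_sub x : A x -> ideal_gen A x.
Proof.
move=> Ax; exists [:: (1, x)]; split; last by rewrite big_seq1 mul1r.
by move=> p; rewrite inE => /eqP->.
Qed.

Lemma ideal_gen_ideal_like : ideal_like (ideal_gen A).
Proof.
split=> [|a x y [s [sA ->]] [r [rA ->]]]; first by exists [::]; split; rewrite ?big_nil.
exists ([seq (a * p.1, p.2) | p <- s] ++ r); split.
  by move=> p; rewrite mem_cat => /orP[/mapP[q qs ->]|]; [exact: (sA q)|exact: rA].
rewrite big_cat big_map big_distrr /=; congr (_ + _).
by apply: eq_bigr => p _; rewrite mulrA.
Qed.

Hypothesis idA : ideal_like A.

Lemma ideal_like0 : A 0. Proof. by case: idA. Qed.

Lemma ideal_likeD x y : A x -> A y -> A (x + y).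
Proof. by move=> Ax Ay; rewrite -[x]mul1r; apply: idA.2. Qed.

Lemma ideal_likeMl a x : A x -> A (a * x).
Proof. by move=> Ax; rewrite -[_ * _]addr0; apply: idA.2 (ideal_like0). Qed.

Lemma ideal_likeMr a x : A x -> A (x * a).
Proof. by rewrite mulrC; apply: ideal_likeMl. Qed.

Lemma ideal_likeN x : A x -> A (- x).
Proof. by rewrite -mulN1r; apply: ideal_likeMl. Qed.

Lemma ideal_likeB x y : A x -> A y -> A (x - y).
Proof. by move=> Ax /ideal_likeN; apply: ideal_likeD. Qed.

Lemma ideal_like_sum (T : eqType) (r : seq T) (P : pred T) (F : T -> R) :
  (forall i, i \in r -> P i -> A (F i)) -> A (\sum_(i <- r | P i) F i).
Proof.
move=> AF; rewrite big_seq_cond; apply: big_ind => //.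
- exact: ideal_like0.
- exact: ideal_likeD.
by move=> i /andP[]; apply: AF.
Qed.

Lemma ideal_like_sub x y : A (x - y) -> A y -> A x.
Proof. by move=> Axy Ay; rewrite -(subrK y x); apply: ideal_likeD. Qed.

End IdealPredicates.

Arguments ideal_likeMl {R A} idA {a x} Ax.
Arguments ideal_likeMr {R A} idA {a x} Ax.

(** * Regular sequences are quasi-regular *)

Section QuasiRegular.
Variables (R : comNzRingType) (k : nat) (L : R -> Prop) (u : 'I_k -> R).
Hypothesis idL : ideal_like L.

(** The ideal [L + (u_0, ..., u_(j-1))]. The index set stays ['I_k] for
    every [j], so that inductions on [j] do not change types. *)
Definition adjoin_prefix (j : nat) (x : R) : Prop :=
  exists c : 'I_k -> R, L (x - \sum_(i < k | (i < j)%N) c i * u i).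

Definition prefix_form (j d : nat) (F : {mpoly R[k]}) : Prop :=
  forall a, a \in msupp F -> mdeg a = d /\ forall i : 'I_k, (j <= i)%N -> a i = 0%N.

(** The ideal [L + (u_0, ..., u_(j-1))^d]: the values at [u] of forms of
    degree [d], modulo [L]. *)
Definition prefix_power (j d : nat) (x : R) : Prop :=
  exists2 F : {mpoly R[k]}, prefix_form j d F & L (x - F.@[u]).

Local Notation I := adjoin_prefix.
Local Notation Pw := prefix_power.

Lemma adjoin_prefix_ideal j : ideal_like (I j).
Proof.
split=> [|a x y [c Lc] [e Le]].
  exists (fun=> 0); rewrite big1 ?subrr; first exact: ideal_like0.
  by move=> i _; rewrite mul0r.
exists (fun i => a * c i + e i).
have -> : a * x + y - \sum_(i < k | (i < j)%N) (a * c i + e i) * u i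
  = a * (x - \sum_(i < k | (i < j)%N) c i * u i)
    + (y - \sum_(i < k | (i < j)%N) e i * u i).
  rewrite (eq_bigr (fun i => a * (c i * u i) + e i * u i)); last first.
    by move=> i _; rewrite mulrDl mulrA.
  by rewrite big_split /= -big_distrr /=; ring.
exact: idL.2.
Qed.

Lemma sub_adjoin_prefix j x : L x -> I j x.
Proof.
move=> Lx; exists (fun=> 0); rewrite big1 ?subr0 // => i _.
by rewrite mul0r.
Qed.

Lemma adjoin_prefix0 x : I 0 x -> L x.
Proof. by case=> c; rewrite big_pred0 ?subr0. Qed.

Lemma adjoin_prefix_mono j l x : (j <= l)%N -> I j x -> I l x.
Proof.
move=> lejl [c Lc]; exists (fun i : 'I_k => if (i < j)%N then c i else 0).
rewrite (bigID (fun i : 'I_k => (i < j)%N)) /= [X in _ - (_ + X)]big1 ?addr0.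
  rewrite (eq_bigl (fun i : 'I_k => (i < j)%N)) => [|i]; last first.
    by rewrite andb_idl // => /leq_trans; apply.
  by rewrite (eq_bigr (fun i => c i * u i)) // => i ->.
by move=> i /andP[_ /negPf->]; rewrite mul0r.
Qed.

Lemma adjoin_prefix_gen j (i : 'I_k) : (i < j)%N -> I j (u i).
Proof.
move=> ltij; exists (fun l => (l == i)%:R).
rewrite (bigD1 i) //= eqxx mul1r big1 ?addr0 ?subrr; first exact: ideal_like0.
by move=> l /andP[_ /negPf->]; rewrite mul0r.
Qed.

Lemma adjoin_prefix_min (A : R -> Prop) j : ideal_like A -> (forall x, L x -> A x) ->
  (forall i : 'I_k, (i < j)%N -> A (u i)) ->
  forall x, I j x -> A x.
Proof.
move=> idA LA uA x [c /LA Ac]; apply: (ideal_like_sub idA Ac).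
by apply: ideal_like_sum => // i _ /uA Au; apply: ideal_likeMl.
Qed.

Lemma prefix_form_coef j d (F : {mpoly R[k]}) a :
  prefix_form j d F -> F@_a != 0 ->
  mdeg a = d /\ forall i : 'I_k, (j <= i)%N -> a i = 0%N.
Proof. by rewrite -mcoeff_msupp => fF; apply: fF. Qed.

Lemma prefix_form_lin j d c F G :
  prefix_form j d F -> prefix_form j d G -> prefix_form j d (c *: F + G).
Proof.
move=> fF fG a /msuppD_le; rewrite mem_cat => /orP[/msuppZ_le|]; [exact: fF|exact: fG].
Qed.

Lemma prefix_form0 j d : prefix_form j d 0.
Proof. by move=> a; rewrite mcoeff_msupp mcoeff0 eqxx. Qed.

Lemma prefix_formD j d F G :
  prefix_form j d F -> prefix_form j d G -> prefix_form j d (F + G).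
Proof. by move=> fF fG; rewrite -[F]scale1r; apply: prefix_form_lin. Qed.

Lemma prefix_formZ j d c F : prefix_form j d F -> prefix_form j d (c *: F).
Proof.
by move=> fF; rewrite -[_ *: _]addr0; apply: prefix_form_lin fF (@prefix_form0 _ _).
Qed.

Lemma prefix_formB j d F G :
  prefix_form j d F -> prefix_form j d G -> prefix_form j d (F - G).
Proof. by move=> fF fG; rewrite -scaleN1r addrC; apply: prefix_form_lin. Qed.

Lemma prefix_formX j (a : 'X_{1..k}) :
  (forall i : 'I_k, (j <= i)%N -> a i = 0%N) -> prefix_form j (mdeg a) 'X_[a].
Proof. by move=> a0 b /mem_msuppXP <-. Qed.

Lemma prefix_form_sum j d (T : eqType) (r : seq T) (P : pred T) F :
  (forall i, i \in r -> P i -> prefix_form j d (F i)) ->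
  prefix_form j d (\sum_(i <- r | P i) F i).
Proof.
move=> fF; rewrite big_seq_cond; apply: big_ind => //.
- exact: prefix_form0.
- exact: prefix_formD.
by move=> i /andP[]; apply: fF.
Qed.

Lemma prefix_formM j d e F G :
  prefix_form j d F -> prefix_form j e G -> prefix_form j (d + e) (F * G).
Proof.
move=> fF fG a /msuppM_le /allpairsP[[b c] /= [/fF[<- b0] /fG[<- c0] ->]].
by rewrite mdegD; split=> // i ij; rewrite mnmDE b0 ?c0.
Qed.

Lemma prefix_form_mono j l d F : (j <= l)%N -> prefix_form j d F -> prefix_form l d F.
Proof.
by move=> lejl fF a /fF[-> a0]; split=> // i li; apply: a0; apply: leq_trans li.
Qed.

Lemma prefix_power_ideal j d : ideal_like (Pw j d).
Proof.
split=> [|a x y [F fF LF] [G fG LG]].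
  by exists 0; rewrite ?meval0 ?subrr; [exact: prefix_form0|exact: ideal_like0].
exists (a *: F + G); first exact: prefix_form_lin.
rewrite mevalD mevalZ.
have -> : a * x + y - (a * F.@[u] + G.@[u]) = a * (x - F.@[u]) + (y - G.@[u]) by ring.
exact: idL.2.
Qed.

Lemma sub_prefix_power j d x : L x -> Pw j d x.
Proof. by exists 0; rewrite ?meval0 ?subr0 //; exact: prefix_form0. Qed.

Lemma prefix_power_form j d F : prefix_form j d F -> Pw j d F.@[u].
Proof. by exists F; rewrite // subrr; apply: ideal_like0. Qed.

Lemma prefix_powerM j d e x y : Pw j d x -> Pw j e y -> Pw j (d + e) (x * y).
Proof.
move=> [F fF LF] [G fG LG]; exists (F * G); first exact: prefix_formM.
rewrite mevalM.
have -> : x * y - F.@[u] * G.@[u] = y * (x - F.@[u]) + (F.@[u] * (y - G.@[u])) by ring.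
by apply: idL.2 => //; apply: ideal_likeMl.
Qed.

Lemma mnm_neq0 (a : 'X_{1..k}) : mdeg a != 0%N -> exists i, a i != 0%N.
Proof.
rewrite mdeg_eq0 => a0; apply/existsP; apply: contraR a0 => /existsPn a0.
by apply/eqP/mnmP=> i; move/eqP: (negPn (a0 i)) => ->; rewrite mnm0E.
Qed.

Lemma mnm_split (a : 'X_{1..k}) i : a i != 0%N -> a = (a - U_(i) + U_(i))%MM.
Proof. by move=> ai; rewrite submK // lep1mP. Qed.

Lemma mdeg_split (a : 'X_{1..k}) i : a i != 0%N -> mdeg a = (mdeg (a - U_(i))%MM).+1.
Proof. by move=> ai; rewrite {1}(mnm_split ai) mdegD mdeg1 addn1. Qed.

Lemma prefix_power_mnm j d (a : 'X_{1..k}) :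
  (forall i : 'I_k, (j <= i)%N -> a i = 0%N) -> (d <= mdeg a)%N ->
  Pw j d ('X_[a] : {mpoly R[k]}).@[u].
Proof.
move=> + /subnK; move: (mdeg a - d)%N => e; elim: e a => [|e IHe] a a0 da.
  by apply: prefix_power_form; rewrite -[d]add0n da; apply: prefix_formX.
have /mnm_neq0[i ai] : mdeg a != 0%N by rewrite -da addSn.
rewrite (mnm_split ai) mpolyXD mevalM.
apply: (ideal_likeMr (@prefix_power_ideal _ _) _).
apply: IHe; last by move: da; rewrite (mdeg_split ai) addSn => -[].
by move=> l jl; rewrite mnmBE a0.
Qed.

Lemma meval_sum_msupp (F : {mpoly R[k]}) :
  F.@[u] = \sum_(a <- msupp F) F@_a * ('X_[a] : {mpoly R[k]}).@[u].
Proof. by rewrite mevalE; apply: eq_bigr => a _; rewrite mevalX. Qed.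

Lemma prefix_power_ge j d (F : {mpoly R[k]}) :
  (forall a, a \in msupp F ->
     (d <= mdeg a)%N /\ forall i : 'I_k, (j <= i)%N -> a i = 0%N) ->
  Pw j d F.@[u].
Proof.
move=> fF; rewrite meval_sum_msupp; apply: (ideal_like_sum (@prefix_power_ideal _ _) _).
move=> a /fF[da a0] _; apply: (ideal_likeMl (@prefix_power_ideal _ _) _).
exact: prefix_power_mnm.
Qed.

Lemma prefix_powerW j d x : Pw j d.+1 x -> Pw j d x.
Proof.
move=> [F fF LF].
apply: (ideal_like_sub (@prefix_power_ideal _ _) (sub_prefix_power _ _ LF) _).
by apply: prefix_power_ge => a /fF[-> a0]; split.
Qed.

Lemma prefix_form_prefix_powerS j d F :
  prefix_form j d F -> (forall a, I j F@_a) -> Pw j d.+1 F.@[u].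
Proof.
move=> fF IF; have idP := @prefix_power_ideal j d.+1.
rewrite meval_sum_msupp; apply: ideal_like_sum => // a /fF[da a0] _.
have [c /(sub_prefix_power j d.+1) Lc] := IF a.
rewrite -(subrK (\sum_(i < k | (i < j)%N) c i * u i) F@_a) mulrDl.
apply: ideal_likeD => //; first exact: ideal_likeMr.
rewrite big_distrl /=; apply: ideal_like_sum => // i _ ij.
rewrite -mulrA; apply: ideal_likeMl => //.
have -> : u i * ('X_[a] : {mpoly R[k]}).@[u] = ('X_[a + U_(i)] : {mpoly R[k]}).@[u].
  by rewrite mpolyXD mevalM mevalXU mulrC.
apply: prefix_power_mnm => [l jl|]; last by rewrite mdegD mdeg1 addn1 da.
rewrite mnmDE a0 // mnm1E; case: eqP => // il.
by move: jl; rewrite -il leqNgt ij.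
Qed.

(** One variable can be taken out of each monomial of degree [d + 1] and
    counted as a coefficient. *)
Lemma prefix_powerS_form j d x : Pw j d.+1 x ->
  exists G, [/\ prefix_form j d G, forall a, I j G@_a & L (x - G.@[u])].
Proof.
pose Q y := exists G, [/\ prefix_form j d G, forall a, I j G@_a & L (y - G.@[u])].
have idI := @adjoin_prefix_ideal j.
have idQ : ideal_like Q.
  split=> [|a y z [F [fF IF LF]] [G [fG IG LG]]].
    exists 0; split; [exact: prefix_form0| |by rewrite meval0 subrr; exact: ideal_like0].
    by move=> a; rewrite mcoeff0; apply: ideal_like0.
  exists (a *: F + G); split; first exact: prefix_form_lin.
    by move=> b; rewrite mcoeffD mcoeffZ; apply: idI.2.
  rewrite mevalD mevalZ.
  have -> : a * y + z - (a * F.@[u] + G.@[u]) = a * (y - F.@[u]) + (z - G.@[u]) by ring.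
  exact: idL.2.
case=> F fF LF; apply: (ideal_like_sub idQ (y := F.@[u])).
  exists 0; split; [exact: prefix_form0| |by rewrite meval0 subr0].
  by move=> a; rewrite mcoeff0; apply: ideal_like0.
rewrite meval_sum_msupp; apply: ideal_like_sum => // a /fF[da a0] _.
apply: ideal_likeMl => //.
have /mnm_neq0[i ai] : mdeg a != 0%N by rewrite da.
have ij : (i < j)%N by rewrite ltnNge; apply: contraNN ai => /a0->.
exists (u i *: 'X_[a - U_(i)]); split.
- apply: prefix_formZ; move: (mdeg_split ai); rewrite da => -[->].
  by apply: prefix_formX => l jl; rewrite mnmBE a0.
- move=> b; rewrite mcoeffZ; apply: ideal_likeMr => //; exact: adjoin_prefix_gen.
rewrite {1}(mnm_split ai) mpolyXD mevalM mevalXU mevalZ mulrC subrr.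
exact: ideal_like0.
Qed.

Hypothesis regu : forall (j : 'I_k) x, I j (u j * x) -> I j x.

(** The shape of quasi-regularity that carries the induction: a form that
    vanishes at [u] modulo [L] has its coefficients in the ideal of the
    first [j] elements. *)
Definition independent_modulo (j d : nat) :=
  forall F, prefix_form j d F -> L F.@[u] -> forall a, I j F@_a.

(** If the value of a form lies one step deeper than its degree, it can be
    rewritten by a form of degree [d] with coefficients in the ideal, and
    the difference of the two forms vanishes at [u]. *)
Lemma quasi_regular_power j d : independent_modulo j d ->
  forall F, prefix_form j d F -> Pw j d.+1 F.@[u] -> forall a, I j F@_a.
Proof.
move=> ind F fF /prefix_powerS_form[G [fG IG LG]] a.
apply: (ideal_like_sub (@adjoin_prefix_ideal j) _ (IG a)).
by rewrite -mcoeffB; apply: ind; [exact: prefix_formB|rewrite mevalB].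
Qed.

(** Regularity of [u_j] modulo an ideal passes to the powers of the ideal,
    since by quasi-regularity the quotients of successive powers are free
    over the quotient by the ideal. *)
Lemma regular_on_power (j : 'I_k) : (forall d, independent_modulo j d) ->
  forall d x, Pw j d (u j * x) -> Pw j d x.
Proof.
move=> ind; elim=> [|d IHd] x Px.
  exists x%:MP; last by rewrite mevalC subrr; apply: ideal_like0.
  move=> a; rewrite msuppC; case: ifP => // _; rewrite inE => /eqP->.
  by rewrite mdeg0; split=> // i _; rewrite mnm0E.
have [X fX LX] := IHd _ (prefix_powerW Px).
apply: (ideal_like_sub (@prefix_power_ideal _ _) (sub_prefix_power _ _ LX)).
apply: prefix_form_prefix_powerS => // a; apply: regu; rewrite -mcoeffZ.
apply: (quasi_regular_power (ind d)); first exact: prefix_formZ.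
rewrite mevalZ; apply: (ideal_like_sub (@prefix_power_ideal _ _) _ Px).
apply: sub_prefix_power; rewrite -mulrBr -opprB mulrN.
by apply: ideal_likeN => //; apply: ideal_likeMl.
Qed.

Lemma prefix_form_split (j : 'I_k) d F : prefix_form j.+1 d.+1 F ->
  exists G H, [/\ prefix_form j d.+1 G, prefix_form j.+1 d H & F = G + 'X_j * H].
Proof.
move=> fF; exists (\sum_(a <- msupp F | a j == 0%N) F@_a *: 'X_[a]).
exists (\sum_(a <- msupp F | a j != 0%N) F@_a *: 'X_[a - U_(j)]); split.
- apply: prefix_form_sum => a /fF[<- a0] /eqP aj.
  apply: prefix_formZ; apply: prefix_formX => i.
  by rewrite leq_eqVlt => /orP[/eqP/val_inj<-//|]; apply: a0.
- apply: prefix_form_sum => a /fF[da a0] aj; apply: prefix_formZ.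
  move: (mdeg_split aj); rewrite da => -[->].
  by apply: prefix_formX => i ji; rewrite mnmBE a0.
rewrite {1}[F]mpolyE (bigID (fun a : 'X_{1..k} => a j == 0%N)) /=; congr (_ + _).
rewrite big_distrr /=; apply: eq_bigr => a aj.
by rewrite -scalerAr -mpolyXD addmC -mnm_split.
Qed.

(** Rees' theorem. If [F = G + T_j H] vanishes at [u], then [u_j H(u)] lies
    in the power of the shorter ideal, on which [u_j] is regular; hence,
    modulo [L], [H(u)] is the value of a form [H'] in fewer variables. The
    case of lower degree applies to [H], and the case of fewer variables to
    [G + u_j H']. *)
Theorem quasi_regular j d : (j <= k)%N -> independent_modulo j d.
Proof.
elim: j d => [|j IHj] d ltjk F fF LF a.
  have F0 b : b != 0%MM -> F@_b = 0.
    apply: contraNeq => /(prefix_form_coef fF)[_ b0].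
    by apply/eqP/mnmP=> i; rewrite b0 // mnm0E.
  have [->|/F0->] := eqVneq a 0%MM; last exact: ideal_like0 (@adjoin_prefix_ideal _).
  apply: sub_adjoin_prefix; suff -> : F@_0 = F.@[u] by [].
  have -> : F = (F@_0)%:MP; last by rewrite mevalC mcoeffC eqxx mulr1.
  apply/mpolyP=> b; rewrite mcoeffC.
  by case: eqVneq => [->|/F0->]; rewrite ?mulr1 ?mulr0.
pose J := Ordinal ltjk; have {}IHj := fun d => IHj d (ltnW ltjk).
elim: d F fF LF a => [|d IHd] F fF LF a.
  suff fF' : prefix_form j 0 F by exact: adjoin_prefix_mono (IHj _ _ fF' LF a).
  move=> b /fF[b0 _]; split=> // i _.
  by move/eqP: b0; rewrite mdeg_eq0 => /eqP->; rewrite mnm0E.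
have [G [H [fG fH defF]]] := @prefix_form_split J d F fF.
have LGH : L (G.@[u] + u J * H.@[u]) by move: LF; rewrite defF mevalD mevalM mevalXU.
have /(@regular_on_power J IHj)[H' fH' LH'] : Pw J d.+1 (u J * H.@[u]).
  rewrite -[_ * _](addKr G.@[u]) addrC.
  apply: (ideal_likeB (@prefix_power_ideal _ _) (sub_prefix_power _ _ LGH) _).
  exact: prefix_power_form.
have IH b : I j.+1 H@_b.
  apply: (quasi_regular_power IHd fH); exists H' => //.
  exact: prefix_form_mono fH'.
have IG b : I j.+1 G@_b.
  have fGH : prefix_form j d.+1 (G + u J *: H').
    by apply: prefix_formD => //; apply: prefix_formZ.
  have LGH' : L (G + u J *: H').@[u].
    rewrite mevalD mevalZ; apply: (ideal_like_sub idL _ LGH).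
    rewrite opprD addrACA subrr add0r -mulrBr.
    by rewrite -opprB mulrN; apply: ideal_likeN => //; apply: ideal_likeMl.
  have idI := @adjoin_prefix_ideal j.+1.
  rewrite -(addrK (u J * H'@_b) G@_b) -mcoeffZ -mcoeffD.
  apply: ideal_likeB => //.
    exact: adjoin_prefix_mono (leqnSn j) (IHj _ _ fGH LGH' b).
  by rewrite mcoeffZ; apply: ideal_likeMr => //; apply: (@adjoin_prefix_gen j.+1 J).
have idI := @adjoin_prefix_ideal j.+1.
rewrite defF mcoeffD; apply: ideal_likeD => //.
rewrite mulrC; have [/mnm_split ->|aJ] := boolP (a J != 0%N).
  by rewrite addmC mcoeffMX.
rewrite memN_msupp_eq0; first exact: ideal_like0.
apply/negP => /msuppM_le /allpairsP[[b c] /= [_ /mem_msuppXP <- defa]].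
by move: aJ; rewrite defa mnmDE mnm1E eqxx addn1.
Qed.

End QuasiRegular.

(** * Polynomial relations between the elements of a regular sequence *)

Section TorsionFree.
Variables (R : comNzRingType) (k : nat).

(** Modulo the ideal, [p] keeps an invertible leading coefficient and so is
    not a zero divisor. *)
Lemma mulp_coef_ideal (A : R -> Prop) (p q : {mpoly R[k]}) : ideal_like A ->
  (exists c, c * p@_(mlead p) = 1) -> (forall a, A (p * q)@_a) -> forall a, A q@_a.
Proof.
move=> idA [c cp]; elim/mleadrect: q => q IHq Apq a.
have [->|q0] := eqVneq q 0; first by rewrite mcoeff0; apply: ideal_like0.
have Aq : A q@_(mlead q).
  by rewrite -[_@__]mul1r -cp -mulrA -mleadcM; apply: ideal_likeMl.
pose q' := q - q@_(mlead q) *: 'X_[mlead q].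
have Aq' b : A q'@_b.
  have [->|q'0] := eqVneq q' 0; first by rewrite mcoeff0; apply: ideal_like0.
  apply: IHq; first exact: ltm_mleadD.
  move=> e; rewrite /q' mulrBr mcoeffB; apply: ideal_likeB => //.
  by rewrite -scalerAr mcoeffZ; apply: ideal_likeMr.
rewrite -(subrK (q@_(mlead q) *: 'X_[mlead q]) q) mcoeffD mcoeffZ.
by apply: ideal_likeD => //; apply: ideal_likeMr.
Qed.

Variables (L : R -> Prop) (u : 'I_k -> R).
Hypothesis idL : ideal_like L.
Hypothesis regu :
  forall (j : 'I_k) x, adjoin_prefix L u j (u j * x) -> adjoin_prefix L u j x.

(** A regular sequence acts like independent variables: the product of the
    lowest form of [F] with a form of degree [t] representing [z] has its
    value in the power of order one more than its degree. By
    quasi-regularity its coefficients lie in the ideal, hence so do those of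
    the form representing [z], and [z] moves from the power [t] to the power
    [t + 1]. *)
Lemma annihilated_in_powers (F : {mpoly R[k]}) z : F != 0 ->
  (forall a, F@_a != 0 -> exists c, c * F@_a = 1) ->
  L (F.@[u] * z) -> forall t, prefix_power L u k t z.
Proof.
move=> F0 Finv LFz; elim=> [|t [Z fZ LZ]].
  exists z%:MP; last by rewrite mevalC subrr; apply: ideal_like0.
  move=> a; rewrite msuppC; case: ifP => // _; rewrite inE => /eqP->.
  by rewrite mdeg0; split=> // i; rewrite mnm0E.
(* [G] is the form of lowest degree in [F], and [H] collects the rest. *)
pose r := mdeg (mlast F).
pose G := \sum_(a <- msupp F | mdeg a == r) F@_a *: 'X_[a].
pose H := \sum_(a <- msupp F | mdeg a != r) F@_a *: 'X_[a].
have FGH : F = G + H by rewrite {1}[F]mpolyE (bigID (fun a : 'X_{1..k} => mdeg a == r)).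
have fG : prefix_form k r G.
  apply: prefix_form_sum => a _ /eqP <-; apply: prefix_formZ; apply: prefix_formX => i.
  by rewrite leqNgt ltn_ord.
have HGE a : H@_a = if mdeg a == r then 0 else F@_a.
  rewrite /H raddf_sum /=; case: ifPn => [/eqP da|da].
    rewrite big1 // => b db; rewrite mcoeffZ mcoeffX.
    by case: (eqVneq b a) db => [->|_ _]; rewrite ?da ?eqxx ?mulr0.
  rewrite -big_filter; have [aF|aF] := boolP (a \in msupp F); last first.
    rewrite (memN_msupp_eq0 aF) big_seq big1 // => b; rewrite mem_filter.
    move=> /andP[_ bF]; rewrite mcoeffZ mcoeffX.
    by case: (eqVneq b a) aF => [<-|_ _]; rewrite ?bF ?mulr0.
  rewrite (bigD1_seq a) ?mem_filter ?da ?filter_uniq ?msupp_uniq //=.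
  rewrite mcoeffZ mcoeffX eqxx mulr1 big1 ?addr0 // => b ba.
  by rewrite mcoeffZ mcoeffX (negPf ba) mulr0.
have GE a : G@_a = if mdeg a == r then F@_a else 0.
  have -> : G = F - H by rewrite FGH addrK.
  by rewrite mcoeffB HGE; case: ifP; rewrite ?subr0 ?subrr.
have G0 : G != 0.
  apply: contraTneq (mlast_supp F0) => G0; rewrite mcoeff_msupp negbK.
  by have := GE (mlast F); rewrite G0 mcoeff0 eqxx => <-.
have Ginv : exists c, c * G@_(mlead G) = 1.
  move: (mlead_supp G0); rewrite mcoeff_msupp GE; case: ifP => _; last by rewrite eqxx.
  exact: Finv.
have idP := @prefix_power_ideal _ _ _ u idL k.
have PH : prefix_power L u k r.+1 H.@[u].
  apply: prefix_power_ge => // a; rewrite mcoeff_msupp HGE.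
  case: ifPn; rewrite ?eqxx // => dar aF; split=> [|i]; last by rewrite leqNgt ltn_ord.
  rewrite ltn_neqAle eq_sym dar; apply: lemc_mdeg; apply: mlast_lemc.
  by rewrite mcoeff_msupp.
(* [F(u) z] vanishes and [H] has larger degree, so [G(u) Z(u)] lies one step
   deeper than its degree. *)
have PGZ : prefix_power L u k (r + t).+1 (G * Z).@[u].
  have -> : (G * Z).@[u] = F.@[u] * z - F.@[u] * (z - Z.@[u]) - H.@[u] * Z.@[u].
    by rewrite mevalM FGH mevalD; ring.
  apply: ideal_likeB => //; last first.
    by rewrite -addSn; apply: prefix_powerM => //; apply: prefix_power_form.
  by apply: sub_prefix_power; apply: ideal_likeB => //; apply: ideal_likeMl.
have qr := @quasi_regular _ _ _ _ idL regu k _ (leqnn k).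
have IGZ : forall a, adjoin_prefix L u k (G * Z)@_a.
  by apply: (quasi_regular_power idL (qr _)) PGZ; apply: prefix_formM.
apply: (ideal_like_sub (idP _) (sub_prefix_power _ _ _ LZ)).
apply: prefix_form_prefix_powerS => //.
exact: mulp_coef_ideal (@adjoin_prefix_ideal _ _ _ u idL k) Ginv IGZ.
Qed.

End TorsionFree.

(** * Algebraic dependence by counting dimensions *)

Section AlgebraicDependence.
Variable K : fieldType.

Lemma msupp_mdeg_prod n (I : finType) (F : I -> {mpoly K[n]}) (d : I -> nat) :
  (forall i b, b \in msupp (F i) -> (mdeg b <= d i)%N) ->
  forall b, b \in msupp (\prod_i F i) -> (mdeg b <= \sum_i d i)%N.
Proof.
move=> Fd; elim/big_rec2: _ => [b|i y p _ IH b].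
  by rewrite msupp1 inE => /eqP->; rewrite mdeg0.
by move=> /msuppM_le /allpairsP[[e f] /= [/Fd de /IH df ->]]; rewrite mdegD leq_add.
Qed.

Lemma msupp_mdeg_exp n (p : {mpoly K[n]}) d e :
  (forall b, b \in msupp p -> (mdeg b <= d)%N) ->
  forall b, b \in msupp (p ^+ e) -> (mdeg b <= e * d)%N.
Proof.
move=> pd b; rewrite -[e in p ^+ e]card_ord -prodr_const.
move=> /(msupp_mdeg_prod (d := fun=> d))-/(_ (fun _ => pd)).
by rewrite sum_nat_const card_ord.
Qed.

Lemma exp_growth C n k : (n < k)%N -> exists2 r, (0 < r)%N & ((C * r).+1 ^ n < r ^ k)%N.
Proof.
move=> ltnk; exists (C.+1 ^ n).+1 => //; set r := (C.+1 ^ n).+1.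
have rn : (C.+1 ^ n * r ^ n < r ^ k)%N.
  apply: (@leq_trans (r ^ n.+1)); last by rewrite leq_pexp2l.
  by rewrite expnS ltn_pmul2r ?expn_gt0 ?ltnSn.
apply: leq_ltn_trans rn.
rewrite -expnMn; case: (posnP n) => [->|n0]; rewrite ?expn0 // leq_exp2r //.
by rewrite mulSn addnC -addn1 leq_add2l.
Qed.

(** The [r ^ k] monomials in the [v i] with exponents below [r] lie in a
    space of polynomials whose dimension grows like [r ^ n]. *)
Lemma algebraic_dependence n k (v : 'I_k -> {mpoly K[n]}) : (n < k)%N ->
  exists2 F : {mpoly K[k]}, F != 0 & mmap (@mpolyC n K) v F = 0.
Proof.
move=> ltnk; pose D := (\max_i msize (v i))%N.
have vD i b : b \in msupp (v i) -> (mdeg b <= D)%N.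
  by move=> /msize_mdeg_lt/ltnW/leq_trans; apply; apply: (leq_bigmax i).
have [r r0] := exp_growth (k * D) ltnk; set B := (k * D * r).+1 => ltBr.
pose T := {ffun 'I_k -> 'I_r}; pose U := {ffun 'I_n -> 'I_B}.
pose mT (f : T) := [multinom val (f i) | i < k].
pose mU (f : U) := [multinom val (f i) | i < n].
pose w (f : T) := mmap1 v (mT f).
have wD f b : b \in msupp (w f) -> (mdeg b < B)%N.
  rewrite ltnS; move/(msupp_mdeg_prod (d := fun=> (r * D)%N)).
  rewrite sum_nat_const card_ord -mulnA (mulnC D); apply=> i e.
  move=> /(msupp_mdeg_exp (vD i))/leq_trans; apply.
  by rewrite mnmE leq_mul2r (ltnW (ltn_ord _)) orbT.
pose A := \matrix_(i < #|T|, j < #|U|) (w (enum_val i))@_(mU (enum_val j)).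
(* A nonzero row vector in the kernel of the matrix of coefficients lists the
   coefficients of a relation. *)
have : kermx A != 0.
  rewrite kermx_eq0 -row_leq_rank -ltnNge (leq_ltn_trans (rank_leq_col A)) //.
  by rewrite !card_ffun !card_ord.
case/rowV0Pn => x /sub_kermxP xA x0.
pose F := \sum_i x 0 i *: 'X_[mT (enum_val i)].
have mT_inj : injective mT.
  by move=> f g /mnmP fg; apply/ffunP=> i; apply: val_inj; have := fg i; rewrite !mnmE.
exists F.
  apply: contraNneq x0 => F0; apply/eqP/rowP=> i; rewrite mxE.
  have := congr1 (mcoeff (mT (enum_val i))) F0; rewrite mcoeff0 raddf_sum /= => <-.
  rewrite (bigD1 i) //= mcoeffZ mcoeffX eqxx mulr1 big1 ?addr0 // => j ji.
  rewrite mcoeffZ mcoeffX (inj_eq mT_inj) (inj_eq enum_val_inj).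
  by rewrite (negPf ji) mulr0.
have -> : mmap (@mpolyC n K) v F = \sum_i x 0 i *: w (enum_val i).
  rewrite /F raddf_sum /=; apply: eq_bigr => i _.
  by rewrite mmapZ mmapX mul_mpolyC.
apply/mpolyP=> b; rewrite mcoeff0 raddf_sum /=.
have [dbB|dbB] := ltnP (mdeg b) B; last first.
  rewrite big1 // => i _; rewrite mcoeffZ memN_msupp_eq0 ?mulr0 //.
  by apply/negP=> /wD; rewrite ltnNge dbB.
have bB i : (b i < B)%N.
  by apply: leq_ltn_trans dbB; rewrite mdegE (bigD1 i) //= leq_addr.
pose f : U := [ffun i => Ordinal (bB i)].
have -> : b = mU f by apply/mnmP=> i; rewrite mnmE ffunE.
have /rowP/(_ (enum_rank f)) := xA; rewrite !mxE => {2}<-.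
by apply: eq_bigr => i _; rewrite mcoeffZ mxE enum_rankK.
Qed.

End AlgebraicDependence.

(** * Monomial ideals and cyclic modules *)

Section MonomialIdeals.
Variables (K : fieldType) (n : nat).
Local Notation S := {mpoly K[n]}.

(** Equivalent to being a monomial ideal, in the form that tests membership
    monomial by monomial. *)
Definition supported (I : idealr S) :=
  forall f, (f \in I) = all (fun a => 'X_[a] \in I) (msupp f).

Lemma ideal_sum_mnm (I : idealr S) f :
  (forall a, a \in msupp f -> 'X_[a] \in I) -> f \in I.
Proof.
move=> If; rewrite [f]mpolyE big_seq; apply: rpred_sum => a /If Ia.
by rewrite -mul_mpolyC idealMr.
Qed.

Lemma ideal_mnm_le (I : idealr S) a b : (a <= b)%MM -> 'X_[a] \in I -> 'X_[b] \in I.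
Proof. by move=> /submK <- Ia; rewrite mpolyXD idealMr. Qed.

Lemma monomial_supported (I : idealr S) : monomial_ideal I -> supported I.
Proof.
move=> [A [Amon IA]] f; apply/idP/allP; last by move=> fI; apply: ideal_sum_mnm => a /fI.
move/IA=> [s [sA ->]] a; rewrite mcoeff_msupp raddf_sum /=.
have [/hasP[p ps pa] _|/hasPn s0] := boolP (has (fun p => (p.1 * p.2)@_a != 0) s).
  move: pa; rewrite -mcoeff_msupp => /msuppM_le /allpairsP[[b c] /= [_ + ->]].
  have [e pe] := Amon _ (sA _ ps); rewrite pe => /mem_msuppXP <-.
  by rewrite mpolyXD idealMr // -pe; apply/IA/ideal_gen_sub/sA.
by rewrite big_seq big1 ?eqxx // => p /s0; rewrite negbK => /eqP.
Qed.

Lemma supported_monomial (I : idealr S) : supported I -> monomial_ideal I.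
Proof.
move=> sI; exists (fun u => is_monomial u /\ u \in I); split=> [u []//|f]; split.
  rewrite sI => /allP fI; exists [seq ((f@_a)%:MP, 'X_[a]) | a <- msupp f]; split.
    by move=> p /mapP[a /fI aI ->] /=; split=> //; exists a.
  by rewrite big_map {1}[f]mpolyE; apply: eq_bigr => a _; rewrite mul_mpolyC.
move=> [s [sA ->]]; rewrite big_seq; apply: rpred_sum => p /sA[_ pI].
exact: idealMr.
Qed.

Lemma supported_cap (I J : idealr S) :
  supported I -> supported J -> supported (ideal_cap I J).
Proof.
move=> sI sJ f; rewrite [LHS]unfold_in /= /ideal_cap sI sJ -all_predI.
by apply: eq_all => a; rewrite [RHS]unfold_in.
Qed.

End MonomialIdeals.

Section QuotientModuleTheory.
Variables (R : comNzRingType) (I : idealr R).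

Lemma quot_piD : {morph @quot_pi R I : f g / f + g}.
Proof. exact: (rmorphD (\pi_({ideal_quot I}))%qT). Qed.

Lemma quot_pi0 : quot_pi I 0 = 0.
Proof. exact: (rmorph0 (\pi_({ideal_quot I}))%qT). Qed.

Lemma quot_piB : {morph @quot_pi R I : f g / f - g}.
Proof. exact: (rmorphB (\pi_({ideal_quot I}))%qT). Qed.

Lemma quot_pi_sum (T : Type) (r : seq T) (P : pred T) F :
  quot_pi I (\sum_(i <- r | P i) F i) = \sum_(i <- r | P i) quot_pi I (F i).
Proof. exact: (big_morph _ quot_piD quot_pi0). Qed.

Lemma quot_pi_eq0 f : (quot_pi I f == 0) = (f \in I).
Proof.
have := Quotient.idealrBE I f 0; rewrite subr0 => ->.
by rewrite -quot_pi0.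
Qed.

Lemma quot_piP f g : quot_pi I f = quot_pi I g <-> f - g \in I.
Proof.
rewrite -quot_pi_eq0 quot_piB subr_eq0; split=> [->|/eqP//]; exact: eqxx.
Qed.

Lemma quot_pi_surj (x : quot_mod I) : exists f, x = quot_pi I f.
Proof. by exists (repr (x : {ideal_quot I})); rewrite /quot_pi reprK. Qed.

Lemma idealr_ideal_like : ideal_like (fun x => x \in I).
Proof.
by split=> [|a x y xI yI]; rewrite ?idealr0 // rpredD // idealMr.
Qed.

(** Submodules of the quotient are traded for ideals containing [I], so that
    no module structure is needed afterwards. *)
Lemma mul_submod_prefix (us : seq R) j f :
  mul_submod (take j us) (quot_pi I f) <->
  adjoin_prefix (fun x => x \in I) (fun i : 'I_(size us) => us`_i) j f.
Proof.
have idP := @adjoin_prefix_ideal _ _ _ (fun i : 'I_(size us) => us`_i)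
  idealr_ideal_like j.
split=> [[s [sus fs]]|[c /quot_piP->]].
  pose g p : R := p.1 * repr (p.2 : {ideal_quot I}).
  apply: (ideal_like_sub idP (y := \sum_(p <- s) g p)).
    apply: sub_adjoin_prefix; apply/quot_piP; rewrite fs quot_pi_sum.
    by apply: eq_bigr => p _; rewrite quot_piM /quot_pi reprK.
  apply: ideal_like_sum => // p /sus pus _; apply: ideal_likeMr => //.
  have [i ij ->] : exists2 i : 'I_(size us), (i < j)%N & p.1 = us`_i.
    have := pus; rewrite -index_mem size_take_min leq_min => /andP[ij iu].
    exists (Ordinal (leq_trans iu (leqnn _))) => //=.
    by rewrite -{1}(nth_index 0 pus) nth_take.
  exact: (@adjoin_prefix_gen R (size us) (fun x => x \in I) (fun i => us`_i)
    idealr_ideal_like).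
exists [seq (us`_i, quot_pi I (c i)) | i : 'I_(size us) <- enum 'I_(size us) & (i < j)%N].
split=> [p /mapP[i]|].
  rewrite mem_filter => /andP[ij _] -> /=.
  by rewrite -(nth_take _ ij) mem_nth // size_take_min leq_min ij ltn_ord.
rewrite big_map big_filter big_enum_cond /= quot_pi_sum.
by apply: eq_bigr => i _; rewrite -quot_piM mulrC.
Qed.

Lemma regular_seq_quot (us : seq R) :
  regular_seq (quot_mod I) us <->
  (forall (i : 'I_(size us)) f,
     adjoin_prefix (fun x => x \in I) (fun i : 'I_(size us) => us`_i) i (us`_i * f) ->
     adjoin_prefix (fun x => x \in I) (fun i : 'I_(size us) => us`_i) i f)
  /\ ~ adjoin_prefix (fun x => x \in I) (fun i : 'I_(size us) => us`_i) (size us) 1.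
Proof.
have idP := @adjoin_prefix_ideal _ _ _ (fun i : 'I_(size us) => us`_i)
  idealr_ideal_like.
split=> -[reg pro]; split.
- by move=> i f; rewrite -!mul_submod_prefix quot_piM; apply: reg.
- case: pro => x; have [f ->] := quot_pi_surj x; rewrite -{1}(take_size us).
  rewrite mul_submod_prefix => nf P1; apply: nf.
  by rewrite -[f]mulr1; apply: ideal_likeMl.
- move=> i iu x; have [f ->] := quot_pi_surj x; rewrite -quot_piM !mul_submod_prefix.
  exact: (reg (Ordinal iu)).
by exists (quot_pi I 1); rewrite -{1}(take_size us) mul_submod_prefix.
Qed.

End QuotientModuleTheory.

(** * The dimension bound for the depth *)

Section DepthBound.
Variable K : fieldType.

Lemma irrelevant_coef0 n (f : {mpoly K[n]}) : irrelevant_ideal f -> f@_0%MM = 0.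
Proof.
move=> [s [sX ->]]; rewrite raddf_sum big_seq big1 //= => p /sX[i pi].
by rewrite rmorphM /= pi mcoeffX mnm1_eq0 mulr0.
Qed.

Definition order_ge n t (f : {mpoly K[n]}) := forall a, a \in msupp f -> (t <= mdeg a)%N.

Lemma order_ge_prod n (T : Type) (r : seq T) (F : T -> {mpoly K[n]}) d :
  (forall i, order_ge (d i) (F i)) ->
  order_ge (\sum_(i <- r) d i) (\prod_(i <- r) F i).
Proof.
move=> Fd; elim: r => [|i r IHr]; first by rewrite !big_nil.
rewrite !big_cons => a /msuppM_le /allpairsP[[b c] /= [/Fd db /IHr dc ->]].
by rewrite mdegD leq_add.
Qed.

Lemma order_ge_exp n t (f : {mpoly K[n]}) e :
  order_ge t f -> order_ge (e * t) (f ^+ e).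
Proof.
move=> ft; rewrite -[e in f ^+ e]card_ord -prodr_const.
have -> : (e * t = \sum_(i < e) t)%N by rewrite sum_nat_const card_ord.
exact: order_ge_prod.
Qed.

Lemma order_ge_meval n k (u : 'I_k -> {mpoly K[n]}) t Z :
  (forall i, order_ge 1 (u i)) -> prefix_form k t Z -> order_ge t Z.@[u].
Proof.
move=> u1 fZ a; rewrite mevalE => /msupp_sum_le /flattenP[_ /mapP[b + ->]].
rewrite filter_predT => /fZ[<- _] /msuppM_le /allpairsP[[c e] /= [_ + ->]].
have ub i : order_ge (b i) (u i ^+ b i).
  by rewrite -[X in order_ge X]muln1; apply: order_ge_exp.
move=> /(order_ge_prod ub); rewrite mdegD (mdegE b) => be.
exact: leq_trans be (leq_addl _ _).
Qed.

Lemma meval_map_mpolyC n k (u : 'I_k -> {mpoly K[n]}) (F : {mpoly K[k]}) :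
  (map_mpoly (@mpolyC n K) F).@[u] = mmap (@mpolyC n K) u F.
Proof.
rewrite /map_mpoly {1}/mmap raddf_sum /=; apply: eq_bigr => a _.
by rewrite mmap1_id mul_mpolyC mevalZ mevalX.
Qed.

(** The bound of the depth by the dimension at an associated prime, here the
    kernel of a map [rho] to a polynomial ring in [c] variables. More than
    [c] elements of [us] satisfy a relation after applying [rho]; its value
    at [us] kills [z], so [z] lies in all powers of [us], although these
    have large order. *)
Lemma regular_seq_size n c (I : idealr {mpoly K[n]})
    (rho : {rmorphism {mpoly K[n]} -> {mpoly K[c]}}) z us :
  supported I -> z \notin I ->
  (forall a, rho a%:MP = a%:MP) -> (forall f, rho f = 0 -> f * z \in I) ->
  (forall u, u \in us -> irrelevant_ideal u) -> regular_seq (quot_mod I) us ->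
  (size us <= c)%N.
Proof.
move=> sI zI rhoC rhoz irr /regular_seq_quot[regu _]; rewrite leqNgt; apply/negP=> ltck.
pose u (i : 'I_(size us)) := us`_i.
have [F F0 FE] := algebraic_dependence (fun i => rho (u i)) ltck.
pose F' := map_mpoly (@mpolyC n K) F.
have F'z : F'.@[u] * z \in I.
  apply: rhoz; rewrite meval_map_mpolyC -[RHS]FE /mmap raddf_sum /=.
  apply: eq_bigr => a _; rewrite rmorphM /= rhoC /mmap1 rmorph_prod; congr (_ * _).
  by apply: eq_bigr => i _; rewrite rmorphXn.
have F'0 : F' != 0.
  apply: contraNneq F0 => F'0; apply/eqP/mpolyP=> a; rewrite mcoeff0.
  by apply/eqP; rewrite -(mpolyC_eq0 n) -mcoeff_map_mpoly -/F' F'0 mcoeff0.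
have Finv a : F'@_a != 0 -> exists c, c * F'@_a = 1.
  rewrite mcoeff_map_mpoly mpolyC_eq0 => Fa; exists ((F@_a)^-1)%:MP.
  by rewrite -mpolyCM mulVf.
(* A monomial of [z] outside [I] survives modulo elements of larger order. *)
have zP := annihilated_in_powers (idealr_ideal_like I) regu F'0 Finv F'z.
move: zI; rewrite sI => /allPn[b bz bI].
have [Z fZ] := zP (mdeg b).+1; rewrite sI => /allP/(_ b).
rewrite (negPf bI) mcoeff_msupp mcoeffB => bZ.
suff Zb : Z.@[u]@_b = 0 by move: bZ; rewrite Zb subr0 -mcoeff_msupp bz => /(_ isT).
apply/eqP; apply: contraTT isT; rewrite -mcoeff_msupp => /(order_ge_meval _ fZ).
rewrite ltnn; apply=> i a aui; rewrite lt0n mdeg_eq0.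
apply: contraTneq aui => ->; rewrite mcoeff_msupp.
by rewrite (irrelevant_coef0 (irr _ (mem_nth 0 (ltn_ord i)))) eqxx.
Qed.

End DepthBound.

Lemma max_natP (P : nat -> Prop) B : (exists k, P k) -> (forall k, P k -> (k <= B)%N) ->
  P (max_nat P) /\ forall l, P l -> (l <= max_nat P)%N.
Proof.
move=> exP PB; apply: (epsilon_spec (inhabits 0%N)
  (fun k => P k /\ forall l, P l -> (l <= k)%N)).
pose p k := if excluded_middle_informative (P k) then true else false.
have pP k : p k <-> P k by rewrite /p; case: excluded_middle_informative.
have exp : exists k, p k by case: exP => k /pP; exists k.
have pB k : p k -> (k <= B)%N by move=> /pP; apply: PB.
case: (ex_maxnP exp pB) => k /pP Pk maxk.
by exists k; split=> // l /pP; apply: maxk.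
Qed.

Section DepthQuot.
Variables (K : fieldType) (n : nat) (I : idealr {mpoly K[n]}).
Hypothesis sI : supported I.

(** The dimension bound, for [z = 1] and [rho] the identity, provides the
    finiteness without which [depth_quot] would be an unspecified number. *)
Lemma depth_quotP :
  (exists us, [/\ size us = depth_quot I, forall u, u \in us -> irrelevant_ideal u
     & regular_seq (quot_mod I) us])
  /\ forall us, (forall u, u \in us -> irrelevant_ideal u) ->
       regular_seq (quot_mod I) us -> (size us <= depth_quot I)%N.
Proof.
have [|k [us [<- irr reg]]|Pd maxd] := @max_natP (fun k => exists us : seq {mpoly K[n]},
    [/\ size us = k, forall u, u \in us -> irrelevant_ideal u
      & regular_seq (quot_mod I) us]) n.
- exists 0%N, [::]; split=> //; apply/regular_seq_quot; split=> [[]//|].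
  by move=> /adjoin_prefix0; rewrite idealr1.
- apply: (regular_seq_size (rho := idfun) (z := 1) sI) reg => //; first by rewrite idealr1.
  by move=> f /= ->; rewrite mul0r idealr0.
by split=> // us irr reg; apply: maxd; exists us.
Qed.

Lemma depth_quot_le c (rho : {rmorphism {mpoly K[n]} -> {mpoly K[c]}}) z :
  z \notin I -> (forall a, rho a%:MP = a%:MP) ->
  (forall f, rho f = 0 -> f * z \in I) -> (depth_quot I <= c)%N.
Proof.
move=> zI rhoC rhoz; have [[us [<- irr reg]] _] := depth_quotP.
exact: (regular_seq_size sI zI rhoC rhoz irr reg).
Qed.

End DepthQuot.

(** * Monomial ideals from sets of exponents *)

Section MonomialIdealOfPredicate.
Variables (K : fieldType) (n : nat).
Local Notation S := {mpoly K[n]}.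

Definition up_closed (P : pred 'X_{1..n}) := forall a b, P b -> P (a + b)%MM.

Definition supp_in (P : pred 'X_{1..n}) : {pred S} := fun f => all P (msupp f).

Lemma supp_in_mem P (f : S) : (f \in supp_in P) = all P (msupp f).
Proof. by []. Qed.

Lemma supp_in_ideal_like P : up_closed P -> ideal_like (fun f => f \in supp_in P).
Proof.
move=> upP; split=> [|a x y xP yP]; first by rewrite supp_in_mem msupp0.
apply/allP=> b /msuppD_le; rewrite mem_cat => /orP[|/(allP yP)//].
by move=> /msuppM_le /allpairsP[[c d] /= [_ /(allP xP) ? ->]]; apply: upP.
Qed.

(** The two proofs are parameters so that the ideal structure below can be
    found from the term alone. *)
Definition mono_ideal P (upP : up_closed P) (P0 : ~~ P 0%MM) : {pred S} := supp_in P.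

Variables (P : pred 'X_{1..n}) (upP : up_closed P) (P0 : ~~ P 0%MM).

Lemma mono_ideal_closed : idealr_closed (mono_ideal upP P0).
Proof.
have [in0 inD] := supp_in_ideal_like upP; split=> //.
by rewrite [_ \in _]supp_in_mem msupp1 /= andbT.
Qed.

HB.instance Definition _ :=
  isIdealr.Build S (mono_ideal upP P0) mono_ideal_closed.

Lemma mem_mono_ideal f : (f \in mono_ideal upP P0) = all P (msupp f).
Proof. by []. Qed.

Lemma mono_ideal_mnm a : ('X_[a] \in mono_ideal upP P0) = P a.
Proof. by rewrite mem_mono_ideal msuppX /= andbT. Qed.

Lemma mono_ideal_supported : supported (mono_ideal upP P0).
Proof.
by move=> f; rewrite mem_mono_ideal; apply: eq_all => a; rewrite mono_ideal_mnm.
Qed.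

End MonomialIdealOfPredicate.

(** * Adjoining variables *)

Section Extension.
Variables (K : fieldType) (n m : nat).
Local Notation S := {mpoly K[n]}.
Local Notation S' := {mpoly K[n + m]}.

Definition xpart (b : 'X_{1..n + m}) : 'X_{1..n} := [multinom b (lshift m i) | i < n].

Definition xinj (a : 'X_{1..n}) : 'X_{1..n + m} :=
  [multinom (if split i is inl j then a j else 0%N) | i < n + m].

Definition yfree (b : 'X_{1..n + m}) := [forall j : 'I_m, b (rshift n j) == 0%N].

Definition iota_vars : S -> S' := comp_mpoly [tuple 'X_(lshift m i) | i < n].

Definition kill_vars : S' -> S :=
  comp_mpoly [tuple (if split i is inl j then 'X_j else 0) | i < n + m].

HB.instance Definition _ := GRing.RMorphism.on iota_vars.
HB.instance Definition _ := GRing.RMorphism.on kill_vars.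

Lemma xinj_lshift a i : xinj a (lshift m i) = a i.
Proof. by rewrite mnmE (unsplitK (inl i)). Qed.

Lemma xinj_rshift a j : xinj a (rshift n j) = 0%N.
Proof. by rewrite mnmE (unsplitK (inr j)). Qed.

Lemma xinjK a : xpart (xinj a) = a.
Proof. by apply/mnmP=> i; rewrite mnmE xinj_lshift. Qed.

Lemma xpartD a b : xpart (a + b) = (xpart a + xpart b)%MM.
Proof. by apply/mnmP=> i; rewrite !(mnmE, mnmDE). Qed.

Lemma mnm_ext (b c : 'X_{1..n + m}) : xpart b = xpart c ->
  (forall j, b (rshift n j) = c (rshift n j)) -> b = c.
Proof.
move=> /mnmP bcx bcy; apply/mnmP=> i; rewrite -[i]splitK.
by case: (split i) => j /=; [have := bcx j; rewrite !mnmE|exact: bcy].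
Qed.

Lemma yfree_xinj a : yfree (xinj a).
Proof. by apply/forallP=> j; rewrite xinj_rshift. Qed.

Lemma yfreeP b : yfree b -> b = xinj (xpart b).
Proof.
move=> /forallP yb; apply: mnm_ext => [|j]; first by rewrite xinjK.
by rewrite xinj_rshift (eqP (yb j)).
Qed.

Lemma kill_varsC a : kill_vars a%:MP = a%:MP. Proof. exact: comp_mpolyC. Qed.

Lemma iota_varsX a : iota_vars 'X_[a] = 'X_[xinj a].
Proof.
rewrite /iota_vars comp_mpolyX mpolyXE_id big_split_ord /=.
rewrite [X in _ * X]big1 ?mulr1; last by move=> j _; rewrite xinj_rshift expr0.
by apply: eq_bigr => i _; rewrite tnth_mktuple xinj_lshift.
Qed.

Lemma kill_varsX b : kill_vars 'X_[b] = if yfree b then 'X_[xpart b] else 0.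
Proof.
rewrite /kill_vars comp_mpolyX big_split_ord /=.
have -> : \prod_(i < n) tnth [tuple (if split i is inl j then 'X_j else 0) | i < n + m]
    (lshift m i) ^+ b (lshift m i) = 'X_[K, xpart b].
  rewrite mpolyXE_id; apply: eq_bigr => i _.
  by rewrite tnth_mktuple (unsplitK (inl i)) mnmE.
case: ifPn => [/forallP yb|].
  rewrite big1 ?mulr1 // => j _.
  by rewrite (eqP (yb j)) expr0.
rewrite negb_forall => /existsP[j bj]; rewrite (bigD1 j) //=.
by rewrite tnth_mktuple (unsplitK (inr j)) expr0n (negPf bj) mul0r mulr0.
Qed.

Lemma iota_varsE f : iota_vars f = \sum_(a <- msupp f) f@_a *: 'X_[xinj a].
Proof.
rewrite {1}/iota_vars comp_mpolyEX; apply: eq_bigr => a _.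
by congr (_ *: _); apply: iota_varsX.
Qed.

Lemma mcoeff_kill f a : (kill_vars f)@_a = f@_(xinj a).
Proof.
rewrite {1}/kill_vars comp_mpolyEX raddf_sum /= [f in RHS]mpolyE raddf_sum /=.
apply: eq_bigr => b _; rewrite !mcoeffZ mcoeffX; congr (_ * _).
have := kill_varsX b; rewrite /kill_vars => ->.
case: ifPn => [/yfreeP yb|nyb].
  by rewrite mcoeffX {2}yb (inj_eq (can_inj xinjK)).
by rewrite mcoeff0; case: eqP nyb => // ->; rewrite yfree_xinj.
Qed.

Lemma iotaK : cancel iota_vars kill_vars.
Proof.
move=> f; apply/mpolyP=> a; rewrite mcoeff_kill iota_varsE raddf_sum /=.
rewrite [f in RHS]mpolyE raddf_sum /=; apply: eq_bigr => b _.
by rewrite !mcoeffZ !mcoeffX (inj_eq (can_inj xinjK)).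
Qed.

Section ExtIdeal.
Variable I : idealr S.
Hypothesis sI : supported I.

Definition xpart_in : pred 'X_{1..n + m} := fun b => 'X_[xpart b] \in I.

Lemma xpart_in_up : up_closed xpart_in.
Proof. by move=> a b; rewrite /xpart_in xpartD mpolyXD => /idealMr; apply. Qed.

Lemma xpart_in0 : ~~ xpart_in 0%MM.
Proof.
rewrite /xpart_in; have -> : xpart 0 = 0%MM by apply/mnmP=> i; rewrite !mnmE.
by rewrite mpolyX0 idealr1.
Qed.

Definition ext_ideal : idealr S' := mono_ideal xpart_in_up xpart_in0.

Lemma ext_ideal_supported : supported ext_ideal.
Proof. exact: mono_ideal_supported. Qed.

Lemma ext_ideal_mnm b : ('X_[b] \in ext_ideal) = ('X_[xpart b] \in I).
Proof. exact: mono_ideal_mnm. Qed.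

Lemma yfreeN_up : up_closed (fun b => ~~ yfree b).
Proof.
move=> a b; rewrite !negb_forall => /existsP[j bj]; apply/existsP; exists j.
by rewrite mnmDE addn_eq0 negb_and bj orbT.
Qed.

Lemma yfreeN0 : ~~ ~~ yfree 0%MM.
Proof. by rewrite negbK; apply/forallP=> j; rewrite mnm0E. Qed.

Definition new_vars_ideal : idealr S' := mono_ideal yfreeN_up yfreeN0.

Lemma new_vars_supported : supported new_vars_ideal.
Proof. exact: mono_ideal_supported. Qed.

Lemma new_vars_mnm b : ('X_[b] \in new_vars_ideal) = ~~ yfree b.
Proof. exact: mono_ideal_mnm. Qed.

Lemma kill_eq0 f : kill_vars f = 0 -> f \in new_vars_ideal.
Proof.
move=> f0; apply/allP=> b; rewrite mcoeff_msupp; apply: contraNN => /yfreeP ->.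
by rewrite -mcoeff_kill f0 mcoeff0.
Qed.

Lemma kill_ext f : f \in ext_ideal -> kill_vars f \in I.
Proof.
move=> /allP fI; rewrite sI; apply/allP=> a; rewrite mcoeff_msupp mcoeff_kill.
by rewrite -mcoeff_msupp => /fI; rewrite /xpart_in xinjK.
Qed.

Lemma iota_ext f : f \in I -> iota_vars f \in ext_ideal.
Proof.
rewrite sI => /allP fI; rewrite iota_varsE big_seq; apply: rpred_sum => a /fI aI.
by rewrite -mul_mpolyC idealMr // ext_ideal_mnm xinjK.
Qed.

Definition new_vars : m.-tuple S' := [tuple 'X_(rshift n j) | j < m].

Lemma new_vars_ideal_gen f :
  f \in new_vars_ideal <-> ideal_gen (fun v => v \in tval new_vars) f.
Proof.
have idG := @ideal_gen_ideal_like S' (fun v => v \in tval new_vars).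
split=> [/allP fJ|[s [sA ->]]].
  rewrite [f]mpolyE; apply: ideal_like_sum => // b /fJ; rewrite negb_forall.
  move=> /existsP[j bj] _; rewrite -mul_mpolyC; apply: ideal_likeMl => //.
  rewrite (mnm_split bj) mpolyXD; apply: ideal_likeMl => //.
  by apply: ideal_gen_sub; apply/tnthP; exists j; rewrite tnth_mktuple.
rewrite big_seq; apply: rpred_sum => p /sA /tnthP[j ->].
rewrite tnth_mktuple idealMr // new_vars_mnm negb_forall.
by apply/existsP; exists j; rewrite mnm1E eqxx.
Qed.

Section RegularExtension.
Variable us : seq S.

Definition ext_seq : seq S' := new_vars ++ map iota_vars us.
Local Notation adjI := (adjoin_prefix (fun x => x \in I) (fun i : 'I_(size us) => us`_i)).
Local Notation adjI' :=
  (adjoin_prefix (fun x => x \in ext_ideal) (fun i : 'I_(size ext_seq) => ext_seq`_i)).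

Lemma size_ext_seq : size ext_seq = (m + size us)%N.
Proof. by rewrite size_cat size_tuple size_map. Qed.

Lemma ext_seq_new (j : 'I_m) : ext_seq`_j = 'X_(rshift n j).
Proof. by rewrite nth_cat size_tuple ltn_ord -tnth_nth tnth_mktuple. Qed.

Lemma ext_seq_old l : (l < size us)%N -> ext_seq`_(m + l) = iota_vars us`_l.
Proof.
move=> lus; rewrite nth_cat size_tuple ltnNge leq_addr addKn (nth_map 0) //.
Qed.

Lemma adj_ext_ideal j : ideal_like (adjI' j).
Proof. exact: (adjoin_prefix_ideal _ (idealr_ideal_like ext_ideal)). Qed.

Lemma adj_gen j i : (i < j)%N -> (i < size ext_seq)%N -> adjI' j ext_seq`_i.
Proof.
move=> ij isz; pose u (i : 'I_(size ext_seq)) := ext_seq`_i.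
exact: (@adjoin_prefix_gen _ _ _ u (idealr_ideal_like ext_ideal) j (Ordinal isz)).
Qed.

Definition new_prefix j : pred 'X_{1..n + m} := fun b =>
  ('X_[xpart b] \in I) || [exists i : 'I_m, (i < j)%N && (b (rshift n i) != 0%N)].

Lemma new_prefix_up j : up_closed (new_prefix j).
Proof.
move=> a b /orP[/(xpart_in_up a) ab|/existsP[i /andP[ij bi]]]; apply/orP; [by left|right].
by apply/existsP; exists i; rewrite ij mnmDE addn_eq0 negb_and bi orbT.
Qed.

(** The new variables come first in [ext_seq]: as long as only they are
    adjoined, the ideal is a monomial ideal, whose regularity conditions are
    read off exponents. *)
Lemma adj_new_prefix j f : (j <= m)%N -> adjI' j f <-> f \in supp_in (new_prefix j).
Proof.
move=> lejm; split.
  move: f; apply: adjoin_prefix_min => [|f /allP fI|i ij].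
  - exact: supp_in_ideal_like (@new_prefix_up j).
  - by apply/allP=> b /fI bI; apply/orP; left.
  rewrite (ext_seq_new (Ordinal (leq_trans ij lejm))) supp_in_mem msuppX /= andbT.
  apply/orP; right; apply/existsP; exists (Ordinal (leq_trans ij lejm)).
  by rewrite ij mnm1E eqxx.
move=> /allP fP; rewrite [f]mpolyE; have idA := adj_ext_ideal j.
apply: ideal_like_sum => // b /fP bP _; rewrite -mul_mpolyC; apply: ideal_likeMl => //.
have [bI|/existsP[i /andP[ij bi]]] := orP bP.
  by apply: sub_adjoin_prefix; rewrite ext_ideal_mnm.
rewrite (mnm_split bi) mpolyXD; apply: ideal_likeMl => //; rewrite -ext_seq_new.
by apply: adj_gen => //; rewrite size_ext_seq (leq_trans (ltn_ord i)) ?leq_addr.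
Qed.

(** Once all the new variables are adjoined, the situation is that of the
    smaller ring. *)
Lemma adj_old_prefix l f : (l <= size us)%N -> adjI' (m + l) f <-> adjI l (kill_vars f).
Proof.
move=> lus; have idA := adj_ext_ideal (m + l).
have idB := @adjoin_prefix_ideal _ _ _ (fun i : 'I_(size us) => us`_i)
  (idealr_ideal_like I) l.
split.
  move: f; apply: adjoin_prefix_min => [|f /kill_ext fI|i il].
  - split=> [|a x y]; first by rewrite rmorph0; apply: ideal_like0.
    by rewrite rmorphD rmorphM; apply: idB.2.
  - exact: sub_adjoin_prefix.
  have [im|mi] := ltnP i m.
    rewrite (ext_seq_new (Ordinal im)) kill_varsX ifF; first exact: ideal_like0.
    apply/negbTE; rewrite negb_forall; apply/existsP; exists (Ordinal im).
    by rewrite mnm1E eqxx.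
  have [iml imu] : (i - m < l)%N /\ (i - m < size us)%N.
    have : (i < m + size us)%N by rewrite -size_ext_seq.
    by lia.
  rewrite -(subnKC mi) ext_seq_old // iotaK.
  exact: (@adjoin_prefix_gen _ _ _ (fun i => us`_(val i)) (idealr_ideal_like I) _
    (Ordinal imu)).
move=> Ikf; rewrite -(subrK (iota_vars (kill_vars f)) f).
apply: ideal_likeD => //.
  apply: (adjoin_prefix_mono (leq_addr l m)); apply/adj_new_prefix => //.
  have : f - iota_vars (kill_vars f) \in new_vars_ideal.
    by apply: kill_eq0; rewrite rmorphB /= iotaK subrr.
  move=> /allP fJ; apply/allP=> b /fJ; rewrite negb_forall => /existsP[j bj].
  by apply/orP; right; apply/existsP; exists j; rewrite ltn_ord.
move: (kill_vars f) Ikf; apply: adjoin_prefix_min => [|g /iota_ext gI|i il].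
- split=> [|a x y]; first by rewrite rmorph0; apply: ideal_like0.
  by rewrite rmorphD rmorphM; apply: idA.2.
- exact: sub_adjoin_prefix.
rewrite -ext_seq_old //; apply: adj_gen; first by rewrite ltn_add2l.
by rewrite size_ext_seq ltn_add2l.
Qed.

Lemma regular_seq_ext :
  regular_seq (quot_mod I) us -> regular_seq (quot_mod ext_ideal) ext_seq.
Proof.
move=> /regular_seq_quot[reg pro]; apply/regular_seq_quot; split=> [i f|]; last first.
  move=> ext1; apply: pro.
  by rewrite -[1](rmorph1 kill_vars) -adj_old_prefix // -size_ext_seq.
have [im|mi] := ltnP i m.
  rewrite !adj_new_prefix ?(ltnW im) // (ext_seq_new (Ordinal im)) => /allP fP.
  apply/allP=> b bf; have /fP : (U_(rshift n (Ordinal im)) + b)%MM \in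
      msupp ('X_(rshift n (Ordinal im)) * f).
    by rewrite mcoeff_msupp mulrC mcoeffMX -mcoeff_msupp.
  case/orP=> [bI|/existsP[j /andP[ji bj]]]; apply/orP; [left|right].
    suff -> : xpart b = xpart (U_(rshift n (Ordinal im)) + b) by [].
    by apply/mnmP=> l; rewrite !mnmE eq_rlshift.
  apply/existsP; exists j; rewrite ji; apply: contraNN bj => /eqP bj.
  rewrite mnmDE bj addn0 mnm1E eq_rshift eqb0.
  by apply: contraTneq ji => <-; rewrite ltnn.
have [l [li lu]] : exists l, i = (m + l)%N :> nat /\ (l < size us)%N.
  have : (i < m + size us)%N by rewrite -size_ext_seq.
  by exists (i - m)%N; lia.
rewrite li ext_seq_old // !adj_old_prefix ?(ltnW lu) // rmorphM /= iotaK.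
exact: (reg (Ordinal lu)).
Qed.

End RegularExtension.

Lemma regular_new_vars : regular_seq (quot_mod ext_ideal) new_vars.
Proof.
have : regular_seq (quot_mod ext_ideal) (ext_seq [::]).
  apply: regular_seq_ext; apply/regular_seq_quot; split=> [[]//|].
  by move=> /adjoin_prefix0; rewrite idealr1.
by rewrite /ext_seq cats0.
Qed.

Lemma depth_ext_ge : (depth_quot I + m <= depth_quot ext_ideal)%N.
Proof.
have [[us [<- irr reg]] _] := depth_quotP sI.
have [_ maxd] := depth_quotP ext_ideal_supported.
rewrite addnC -size_ext_seq; apply: maxd; last exact: regular_seq_ext.
move=> u; rewrite mem_cat => /orP[/tnthP[j ->]|/mapP[f /irr[s [sX ->]] ->]].
  by rewrite tnth_mktuple; apply: ideal_gen_sub; exists (rshift n j).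
exists [seq (iota_vars p.1, iota_vars p.2) | p <- s]; split.
  move=> p /mapP[q /sX[i qi] ->] /=; exists (lshift m i).
  rewrite qi iota_varsX; congr 'X_[_]; apply: mnm_ext => [|j].
    by apply/mnmP=> l; rewrite xinjK !mnmE eq_lshift.
  by rewrite xinj_rshift mnm1E eq_lrshift.
rewrite big_map (rmorph_sum iota_vars); apply: eq_bigr => p _.
exact: (rmorphM iota_vars).
Qed.

(** For [x^a] in [I], the class of [x^a] modulo the intersection is nonzero
    and is killed by the kernel of [kill_vars]. *)
Lemma depth_ext_cap_le : nonzero_ideal I ->
  (depth_quot (ideal_cap ext_ideal new_vars_ideal) <= n)%N.
Proof.
move=> [f fI f0]; have aI : 'X_[mlead f] \in I.
  by move: fI; rewrite sI => /allP; apply; apply: mlead_supp.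
apply: (@depth_quot_le _ _ _ (supported_cap ext_ideal_supported new_vars_supported)
  n kill_vars 'X_[xinj (mlead f)]).
- by rewrite [_ \in _]unfold_in new_vars_mnm yfree_xinj andbF.
- exact: kill_varsC.
move=> g /kill_eq0 gJ; rewrite [_ \in _]unfold_in; apply/andP; split.
  by rewrite idealMr // ext_ideal_mnm xinjK.
by rewrite mulrC idealMr.
Qed.

End ExtIdeal.
End Extension.

(** * Stanley decompositions as partitions of monomials into cells *)

Section Cells.
Variable n : nat.

(** The exponents of the monomials of [x^a K[Z]]. *)
Definition cell (a : 'X_{1..n}) (Z : {set 'I_n}) (b : 'X_{1..n}) :=
  [forall j, if j \in Z then (a j <= b j)%N else b j == a j].

Lemma cellP (a : 'X_{1..n}) (Z : {set 'I_n}) (b : 'X_{1..n}) :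
  reflect (forall j, if j \in Z then (a j <= b j)%N else b j == a j) (cell a Z b).
Proof. exact: forallP. Qed.

Lemma cell_le a Z b : cell a Z b -> (a <= b)%MM.
Proof.
move=> /cellP ab; apply/mnm_lepP=> j; have := ab j.
by case: ifP => // _ /eqP->.
Qed.

Lemma cell_refl a Z : cell a Z a.
Proof. by apply/cellP=> j; case: ifP. Qed.

Lemma cell_add (a : 'X_{1..n}) (Z : {set 'I_n}) (e : 'X_{1..n}) :
  (forall j, e j != 0%N -> j \in Z) -> cell a Z (e + a)%MM.
Proof.
move=> eZ; apply/cellP=> j; rewrite mnmDE; have := eZ j.
by case: ifP => _; rewrite ?leq_addl //; case: eqP => [->|_ /(_ isT)].
Qed.

Lemma cell_sub (a : 'X_{1..n}) (Z : {set 'I_n}) (b : 'X_{1..n}) j :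
  cell a Z b -> (b - a)%MM j != 0%N -> j \in Z.
Proof.
move=> /cellP/(_ j); rewrite mnmBE; case: ifP => // _ /eqP->.
by rewrite subnn.
Qed.

End Cells.

Section StanleyCells.
Variables (K : fieldType) (n : nat) (I : idealr {mpoly K[n]}).
Hypothesis sI : supported I.
Local Notation S := {mpoly K[n]}.

Definition cell_decomposition t (a : 'I_t -> 'X_{1..n}) (Z : 'I_t -> {set 'I_n}) :=
  [/\ forall i b, cell (a i) (Z i) b -> ('X_[b] : S) \notin I,
      forall b, ('X_[b] : S) \notin I -> exists i, cell (a i) (Z i) b
    & forall i j b, cell (a i) (Z i) b -> cell (a j) (Z j) b -> i = j].

Lemma supported_coef f b : f \in I -> ('X_[b] : S) \notin I -> f@_b = 0.
Proof.
rewrite sI => /allP fI bI; apply/eqP; rewrite mcoeff_eq0.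
by apply: contra bI => /fI.
Qed.

Lemma subpoly_cell Z (f : S) a b : subpoly Z f -> (f * 'X_[a])@_b != 0 -> cell a Z b.
Proof.
rewrite -mcoeff_msupp => fZ /msuppM_le /allpairsP[[c e] /= [/fZ cZ /mem_msuppXP <- ->]].
exact: cell_add.
Qed.

Lemma cell_subpoly Z (p : S) a : (forall b, b \in msupp p -> cell a Z b) ->
  exists2 f, subpoly Z f & p = f * 'X_[a].
Proof.
move=> pZ; exists (\sum_(b <- msupp p) p@_b *: 'X_[b - a]).
  move=> c /msupp_sum_le /flattenP[_ /mapP[b + ->]]; rewrite filter_predT => bp.
  move=> /msuppZ_le /mem_msuppXP <- j; exact: cell_sub (pZ _ bp).
rewrite {1}[p]mpolyE big_distrl /= big_seq [RHS]big_seq; apply: eq_bigr => b /pZ ab.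
by rewrite -scalerAl -mpolyXD submK ?(cell_le ab).
Qed.

(** The component of [f] in a cell is the part of [f] supported there; it is
    unique because no monomial of a cell lies in [I]. *)
Lemma cell_decomposition_stanley t (a : 'I_t -> 'X_{1..n}) Z :
  cell_decomposition a Z ->
  stanley_decomposition (@quot_grading K n I) (fun i => quot_pi I 'X_[a i]) Z.
Proof.
move=> [cellI cov dis]; split.
- move=> i; exists [ffun j => (a i j)%:Z%R]; exists 'X_[a i] => // b.
  by move=> /mem_msuppXP <- j; rewrite ffunE.
- move=> i f fZ /eqP; rewrite -quot_piM quot_pi_eq0 => fI.
  have fa0 : f * 'X_[a i] = 0.
    apply/mpolyP=> b; rewrite mcoeff0; apply/eqP; apply: contraT => fb.
    have := fb; rewrite (supported_coef fI) ?eqxx //.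
    exact: cellI (subpoly_cell fZ fb).
  apply/mpolyP=> b; have := congr1 (mcoeff (a i + b)%MM) fa0.
  by rewrite mcoeffMX !mcoeff0.
move=> x; have [f ->] := quot_pi_surj x.
pose p i := \sum_(b <- msupp f | cell (a i) (Z i) b) f@_b *: ('X_[b] : S).
have pE i b : (p i)@_b = if cell (a i) (Z i) b then f@_b else 0.
  rewrite raddf_sum /= [f in RHS]mpolyE raddf_sum /=; case: ifPn => ab.
    rewrite big_mkcond /=; apply: eq_bigr => c _; case: ifPn => // ac.
    by rewrite mcoeffZ mcoeffX; case: eqP ac => [->|_ _]; rewrite ?ab ?mulr0.
  rewrite big1 // => c ac; rewrite mcoeffZ mcoeffX.
  by case: eqP ac ab => [->->//|]; rewrite mulr0.
exists [ffun i => quot_pi I (p i)]; split; first split.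
- move=> i; rewrite ffunE; have [|g gZ ->] := @cell_subpoly (Z i) (p i) (a i).
    by move=> b; rewrite mcoeff_msupp pE; case: ifP; rewrite ?eqxx.
  by exists g => //; rewrite quot_piM.
- under eq_bigr do rewrite ffunE.
  rewrite -quot_pi_sum; apply/quot_piP; rewrite sI; apply/allP=> b.
  rewrite mcoeff_msupp; apply: contraR => bI; rewrite mcoeffB raddf_sum /=.
  have [i ib] := cov b bI; rewrite (bigD1 i) //= pE ib big1 ?addr0 ?subrr // => j ji.
  rewrite pE ifF //; apply: contraNF ji => jb.
  by apply/eqP; apply: dis jb ib.
move=> v [vZ fv]; apply/ffunP=> i; rewrite ffunE.
have /fin_all_exists2[g gZ vg] : forall i, exists2 g : S, subpoly (Z i) g &
    v i = quot_pi I (g * 'X_[a i]).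
  by move=> j; have [g gZ ->] := vZ j; exists g => //; rewrite quot_piM.
rewrite vg; congr (quot_pi I _); apply/mpolyP=> b; rewrite pE.
case: ifPn => [ab|nab]; last first.
  by apply/esym/eqP; apply: contraNT nab; apply: subpoly_cell.
have fg : f - \sum_j g j * 'X_[a j] \in I.
  by apply/quot_piP; rewrite fv quot_pi_sum; apply: eq_bigr => j _.
have := supported_coef fg (cellI _ _ ab); rewrite mcoeffB => /eqP.
rewrite subr_eq0 => /eqP->; rewrite raddf_sum (bigD1 i) //= big1 ?addr0 // => j ji.
apply/eqP; apply: contraNT ji => /(subpoly_cell (gZ j)) jb.
by apply/eqP; apply: dis jb ab.
Qed.

(** A homogeneous element of the quotient is a multiple of a monomial, so
    each summand is spanned by the monomials of a cell. Uniqueness of the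
    decomposition of a monomial makes the cells disjoint. *)
Lemma stanley_cell_decomposition t m (Z : 'I_t -> {set 'I_n}) :
  stanley_decomposition (@quot_grading K n I) m Z ->
  exists a, cell_decomposition a Z.
Proof.
move=> [hom free uni].
have /fin_all_exists[ac mE] : forall i, exists ac : 'X_{1..n} * K,
    ac.2 != 0 /\ m i = quot_pi I (ac.2 *: 'X_[ac.1]).
  move=> i; have [d [f fd mf]] := hom i.
  have f0 : f != 0.
    apply/eqP => f0; suff /eqP : 1 = 0 :> S by rewrite oner_eq0.
    apply: (free i); last by rewrite mf f0 quot_pi0 scaler0.
    by move=> a; rewrite msupp1 inE => /eqP-> j; rewrite mnm0E.
  exists (mlead f, f@_(mlead f)); rewrite mleadc_eq0; split=> //.
  rewrite mf; congr (quot_pi I _); rewrite {1}[f]mpolyE.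
  rewrite (bigD1_seq (mlead f)) ?msupp_uniq ?mlead_supp //= big_seq_cond big1 ?addr0 //.
  move=> b /andP[bf bn]; case/eqP: bn; apply/mnmP=> j; apply/eqP.
  by rewrite -eqz_nat (fd _ bf) (fd _ (mlead_supp f0)).
pose a i := (ac i).1; pose c i := (ac i).2.
have c0 i : c i != 0 by case: (mE i).
have spaceX i b : cell (a i) (Z i) b ->
    stanley_space (m i) (Z i) (quot_pi I 'X_[b]).
  move=> ab; have [|g gZ gE] := @cell_subpoly (Z i) 'X_[b] (a i).
    by move=> _ /mem_msuppXP <-.
  exists ((c i)^-1 *: g); first by move=> e /msuppZ_le; apply: gZ.
  rewrite (mE i).2 -quot_piM -/(c i) -/(a i) -scalerAl -scalerAr scalerA.
  by rewrite mulVf // scale1r -gE.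
have cellI i b : cell (a i) (Z i) b -> ('X_[b] : S) \notin I.
  move=> ab; apply/negP => bI; have e0 := @cell_sub _ _ _ _ _ ab.
  have : 'X_[b - a i] = 0 :> S.
    apply: (free i) => [e /mem_msuppXP <-//|]; apply/eqP.
    rewrite (mE i).2 -quot_piM quot_pi_eq0 -/(a i) -scalerAr -mpolyXD submK ?(cell_le ab) //.
    by rewrite -mul_mpolyC idealMr.
  by move/eqP; rewrite -msize_poly_eq0 msizeX.
exists a; split=> // [b bI|i j b ib jb].
- have [v [[vZ bv] _]] := uni (quot_pi I 'X_[b]).
  have /fin_all_exists2[g gZ vg] : forall i, exists2 g : S, subpoly (Z i) g &
      v i = quot_pi I (g * (c i *: 'X_[a i])).
    move=> i; have [g gZ ->] := vZ i; exists g => //.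
    by rewrite quot_piM (mE i).2.
  have fg : 'X_[b] - \sum_i g i * (c i *: 'X_[a i]) \in I.
    by apply/quot_piP; rewrite bv quot_pi_sum; apply: eq_bigr.
  have := supported_coef fg bI; rewrite mcoeffB mcoeffX eqxx raddf_sum /= => /eqP.
  rewrite subr_eq0 eq_sym.
  have [/existsP[i gi] _|/existsPn g0] := boolP [exists i, (g i * (c i *: 'X_[a i]))@_b != 0].
    exists i; apply: subpoly_cell (gZ i) _.
    by move: gi; rewrite -scalerAr mcoeffZ mulf_eq0 negb_or => /andP[].
  by rewrite big1 ?(eq_sym 0) ?oner_eq0 // => i _; apply/eqP; move: (g0 i); rewrite negbK.
apply/eqP; apply: contraT => ij.
(* A monomial in two cells would have two different decompositions. *)
pose w l : {ffun 'I_t -> quot_mod I} := [ffun s => if s == l then quot_pi I 'X_[b] else 0].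
have w_ok l : cell (a l) (Z l) b ->
    (forall s, stanley_space (m s) (Z s) (w l s)) /\ quot_pi I 'X_[b] = \sum_s w l s.
  move=> lb; split=> [s|]; last first.
    rewrite (bigD1 l) //= ffunE eqxx big1 ?addr0 // => s /negPf sl.
    by rewrite ffunE sl.
  rewrite ffunE; case: eqP => [->|_]; first exact: spaceX.
  by exists 0; rewrite ?scale0r // => e; rewrite msupp0.
have [v [_ vuni]] := uni (quot_pi I 'X_[b]).
have := congr1 (fun w : {ffun 'I_t -> quot_mod I} => w i)
  (etrans (esym (vuni _ (w_ok i ib))) (vuni _ (w_ok j jb))).
rewrite !ffunE eqxx (negPf ij) => /eqP; rewrite quot_pi_eq0.
by rewrite (negPf (cellI _ _ ib)).
Qed.

End StanleyCells.

(** * Constructing cell decompositions *)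

Section Retraction.
Variables (K : fieldType) (n : nat) (I : idealr {mpoly K[n]}).
Local Notation S := {mpoly K[n]}.

(** A partition into cells is given by the function sending an exponent to
    its cell, provided that this function is constant on each cell. Every
    cell is then named by its own lowest element, and a degree bound on
    these leaves finitely many cells. *)
Lemma cell_decomposition_retraction (bot : 'X_{1..n} -> 'X_{1..n})
    (top : 'X_{1..n} -> {set 'I_n}) D :
  (forall b, ('X_[b] : S) \notin I -> [/\ cell (bot b) (top b) b, (mdeg (bot b) < D)%N
     & forall c, cell (bot b) (top b) c ->
         [/\ ('X_[c] : S) \notin I, bot c = bot b & top c = top b]]) ->
  exists t (a : 'I_t -> 'X_{1..n}) Z,
    cell_decomposition I a Z /\ forall i, exists2 b, ('X_[b] : S) \notin I & Z i = top b.
Proof.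
move=> ret.
pose A := [pred p : 'X_{1..n < D} | ('X_[p : 'X_{1..n}] : S) \notin I & bot p == p].
pose a (i : 'I_#|A|) : 'X_{1..n} := bmnm (enum_val i).
have aA i : ('X_[a i] : S) \notin I /\ bot (a i) = a i.
  by have /andP[? /eqP] := enum_valP i.
have aret i b : cell (a i) (top (a i)) b ->
    ('X_[b] : S) \notin I /\ bot b = a i.
  by have [aI ai] := aA i; have [_ _ +] := ret _ aI; rewrite ai => + ab => /(_ _ ab)[? -> _].
exists #|A|, a, (fun i => top (a i)); split; last first.
  by move=> i; exists (a i) => //; case: (aA i).
split=> [i b /aret[]//|b bI|i j b /aret[_ ib] /aret[_ jb]].
  have [bb db cret] := ret _ bI; have [cI botK topK] := cret _ (cell_refl _ _).
  have pA : BMultinom db \in A by rewrite inE /= cI; apply/eqP.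
  by exists (enum_rank_in pA (BMultinom db)); rewrite /a enum_rankK_in //= topK.
by apply: enum_val_inj; apply: val_inj; exact: etrans (esym ib) jb.
Qed.

End Retraction.

Section Dickson.
Variable n : nat.

Definition truncate D (b : 'X_{1..n}) := [multinom minn (b i) D | i < n].

(** Dickson's lemma as the existence of a threshold beyond which exponents
    do not matter. Given one [u] in [P], an element [b] of [P] either
    dominates [u], and truncation above [u] keeps it in [P], or has a
    coordinate below that of [u], and this coordinate is fixed to one of
    finitely many values. *)
Lemma up_closed_truncate (P : pred 'X_{1..n}) : up_closed P ->
  exists D, forall b, P b -> P (truncate D b).
Proof.
move=> upP; have leP a b : (a <= b)%MM -> P a -> P b.
  by move=> /submK <-; apply: upP.
pose trunc (F : {set 'I_n}) D (b : 'X_{1..n}) :=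
  [multinom (if i \in F then b i else minn (b i) D) | i < n].
(* On the coordinates in [F] the exponent is prescribed by [c] and is not
   truncated. *)
suff claim N (F : {set 'I_n}) (c : 'X_{1..n}) : (#|~: F| <= N)%N ->
    exists D, forall b : 'X_{1..n},
      (forall i, i \in F -> b i = c i) -> P b -> P (trunc F D b).
  have [D PD] := claim #|~: (set0 : {set 'I_n})| set0 0%MM (leqnn _).
  exists D => b /PD; have -> : trunc set0 D b = truncate D b.
    by apply/mnmP=> i; rewrite !mnmE inE.
  by apply=> i; rewrite inE.
elim: N F c => [|N IHN] F c FN.
  exists 0%N => b _; have -> // : trunc F 0%N b = b.
  apply/mnmP=> i; rewrite mnmE; case: ifPn => // iF.
  have : i \in ~: F by rewrite inE.
  by move: FN; rewrite leqn0 cards_eq0 => /eqP->; rewrite inE.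
case: (classic (exists2 u : 'X_{1..n}, P u & forall i, i \in F -> u i = c i))
  => [[u Pu uF]|noU]; last first.
  by exists 0%N => b bF Pb; case: noU; exists b.
pose M := (\max_i u i).+1.
have uM i : (u i < M)%N by rewrite ltnS (leq_bigmax i).
pose put i v := [multinom (if j == i then v else c j) | j < n].
have /fin_all_exists[D PD] : forall iv : 'I_n * 'I_M, exists D, iv.1 \notin F ->
    forall b : 'X_{1..n},
    (forall j, j \in iv.1 |: F -> b j = put iv.1 (val iv.2) j) -> P b ->
    P (trunc (iv.1 |: F) D b).
  move=> [i v] /=; have [iF|iF] := boolP (i \in F); first by exists 0%N.
  have [|D PD] := IHN (i |: F) (put i (val v)); last by exists D.
  by move: FN; rewrite (cardsD1 i) inE iF setCU setIC -setDE.
(* The threshold exceeds all coordinates of [u] and all the thresholds obtained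
   after fixing one more coordinate. *)
pose Dm := (M + \max_iv D iv)%N; exists Dm => b bF Pb.
have uD i : (u i <= Dm)%N by rewrite (leq_trans (ltnW (uM i))) ?leq_addr.
have [/forallP ub|/forallPn[i]] := boolP [forall i, (u i <= b i)%N].
  apply: leP Pu; apply/mnm_lepP=> i; rewrite mnmE.
  by case: ifP => // _; rewrite leq_min ub uD.
rewrite -ltnNge => bui.
have iF : i \notin F by apply: contraL bui => iF; rewrite bF // uF // ltnn.
pose iv : 'I_n * 'I_M := (i, Ordinal (ltn_trans bui (uM i))).
have : P (trunc (i |: F) (D iv) b).
  apply: (PD iv) => // j /=; rewrite !inE mnmE; case: eqP => [->//|_ /= jF].
  exact: bF.
apply: leP; apply/mnm_lepP=> j; rewrite !mnmE !inE.
have DDm : (D iv <= Dm)%N.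
  by apply: leq_trans (leq_addl _ _); apply: (leq_bigmax iv).
case: eqP => [->|_] /=; last by case: ifP => // _; lia.
by rewrite (negPf iF) leq_min leqnn (leq_trans (ltnW bui)).
Qed.

End Dickson.

(** * Partitions of the nonempty subsets into intervals *)

Section SubsetPartition.

(** The interval of [A] is [bot A, top A]; the last clause says that the
    intervals of two sets are equal or disjoint. *)
Definition interval_partition (T : finType) k (bot top : {set T} -> {set T}) :=
  forall A : {set T}, A != set0 ->
  [/\ bot A != set0, bot A \subset A, A \subset top A, (k <= #|top A|)%N
    & forall B : {set T}, bot A \subset B -> B \subset top A ->
        bot B = bot A /\ top B = top A].

Lemma ord3_cases (i l : 'I_3) : [\/ l = i, l = ord_pred i | l = ord_pred (ord_pred i)].
Proof.
have : [|| l == i, l == ord_pred i | l == ord_pred (ord_pred i)].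
  by rewrite -!val_eqE; case: i => [[|[|[|//]]] ?]; case: l => [[|[|[|//]]] ?].
by move=> /or3P[]/eqP; [constructor 1|constructor 2|constructor 3].
Qed.

Lemma ord3_pred (i : 'I_3) :
  [/\ ord_pred i != i, ord_pred (ord_pred i) != i & ord_pred (ord_pred (ord_pred i)) = i].
Proof. by case: i => [[|[|[|//]]] ?]; split=> //; apply: val_inj. Qed.

Section Triple.
Variable T : finType.

Definition slice (A : {set T * 'I_3}) i := [set t | (t, i) \in A].
Definition stack (f : 'I_3 -> {set T}) := [set p | p.1 \in f p.2].

Lemma slice_stack f i : slice (stack f) i = f i.
Proof. by apply/setP=> t; rewrite !inE. Qed.

Lemma slice_subset (A B : {set T * 'I_3}) :
  (A \subset B) <-> forall i, slice A i \subset slice B i.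
Proof.
split=> [/subsetP AB i|AB]; apply/subsetP; first by move=> t; rewrite !inE; apply: AB.
by move=> [t i] tA; have /subsetP/(_ t) := AB i; rewrite !inE; apply.
Qed.

Lemma slice_neq0 (A : {set T * 'I_3}) : A != set0 <-> exists i, slice A i != set0.
Proof.
split=> [/set0Pn[[t i] tA]|[i /set0Pn[t]]].
  by exists i; apply/set0Pn; exists t; rewrite inE.
by rewrite inE => tA; apply/set0Pn; exists (t, i).
Qed.

(** With the three slices in cyclic order, an empty slice followed by a
    nonempty one; at most one exists. *)
Definition start (A : {set T * 'I_3}) :=
  [pick i | slice A i != set0 & slice A (ord_pred i) == set0].

Lemma start_some A i :
  slice A i != set0 -> slice A (ord_pred i) = set0 -> start A = Some i.
Proof.
move=> Ai Api; rewrite /start; case: pickP => [l /andP[Al Apl]|/(_ i)]; last first.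
  by rewrite Ai Api eqxx.
case: (ord3_cases i l) Al Apl => -> //; first by rewrite Api eqxx.
by case: (ord3_pred i) => _ _ ->; rewrite (negPf Ai).
Qed.

Lemma start_none A : (forall i, slice A i != set0) -> start A = None.
Proof.
move=> A0; rewrite /start; case: pickP => // l /andP[_].
by rewrite (negPf (A0 _)).
Qed.

Lemma startN_slice A : A != set0 -> start A = None -> forall i, slice A i != set0.
Proof.
move=> /slice_neq0[i Ai]; rewrite /start; case: pickP => // noA _.
have step l : slice A l != set0 -> slice A (ord_pred l) != set0.
  by move=> Al; have := noA l; rewrite Al /= => ->.
by move=> l; case: (ord3_cases i l) => -> //; [apply/step|apply/step/step].
Qed.

Lemma card_stack f : #|stack f| = (\sum_i #|f i|)%N.
Proof.
rewrite -sum1_card (eq_bigl (fun p => p.1 \in f p.2)) => [|p]; last by rewrite inE.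
rewrite -(pair_big_dep xpredT (fun t i => t \in f i) (fun _ _ => 1%N)) /=.
rewrite (exchange_big_dep xpredT) //=.
by apply: eq_bigr => i _; rewrite sum1_card.
Qed.

Variables (bot top : {set T} -> {set T}).

(** The partition on three copies of [T]. If some slice is empty, a nonempty
    slice [i] comes right after an empty one; slice [i] follows the given
    partition and the slice after it is free. Otherwise the three slices
    follow the given partition independently. *)
Definition bot3 A := match start A with
  | Some i => stack (fun l => if l == i then bot (slice A i) else set0)
  | None => stack (fun l => bot (slice A l)) end.

Definition top3 A := match start A with
  | Some i => stack (fun l => if l == i then top (slice A i)
                              else if l == ord_pred i then set0 else setT)
  | None => stack (fun l => top (slice A l)) end.

(** The upper ends grow: in the first case by a full copy of [T], in the
    second case three upper ends add up. *)
Lemma interval_partition_triple k : (0 < k)%N -> (0 < #|T|)%N ->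
  interval_partition k bot top -> interval_partition k.+1 bot3 top3.
Proof.
move=> k0 T0 part A A0; case sA: (start A) => [i|]; last first.
  have An0 := startN_slice A0 sA; rewrite /bot3 /top3 sA; split.
  - apply/slice_neq0; exists ord0; rewrite slice_stack.
    by case: (part _ (An0 ord0)).
  - by apply/slice_subset=> l; rewrite slice_stack; case: (part _ (An0 l)).
  - by apply/slice_subset=> l; rewrite slice_stack; case: (part _ (An0 l)).
  - rewrite card_stack !big_ord_recl big_ord0.
    have kl l : (k <= #|top (slice A l)|)%N by case: (part _ (An0 l)).
    have := kl ord0; have := kl (lift ord0 ord0).
    by have := kl (lift ord0 (lift ord0 ord0)); lia.
  move=> B /slice_subset botB /slice_subset Btop.
  have Bl l : bot (slice B l) = bot (slice A l) /\ top (slice B l) = top (slice A l).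
    have [_ _ _ _ int] := part _ (An0 l).
    by apply: int; [have := botB l|have := Btop l]; rewrite slice_stack.
  have -> : start B = None.
    apply: start_none => l; have [bot0 _ _ _ _] := part _ (An0 l).
    apply: contraNneq bot0 => Bl0; have := botB l.
    by rewrite slice_stack Bl0 subset0.
  split; apply/setP=> -[t l]; rewrite !inE /=; case: (Bl l) => [botE topE].
    by rewrite botE.
  by rewrite topE.
have [Ai Api] : slice A i != set0 /\ slice A (ord_pred i) = set0.
  by move: sA; rewrite /start; case: pickP => // l /andP[Al /eqP Apl] [<-].
have [bot0 botA Atop ktop int] := part _ Ai.
have [pi ppi _] := ord3_pred i; rewrite /bot3 /top3 sA; split.
- by apply/slice_neq0; exists i; rewrite slice_stack eqxx.
- apply/slice_subset=> l; rewrite slice_stack.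
  by case: eqP => [->//|_]; rewrite sub0set.
- apply/slice_subset=> l; rewrite slice_stack.
  case: eqP => [->//|_]; case: eqP => [->|_]; last exact: subsetT.
  by rewrite Api sub0set.
- rewrite card_stack (bigD1 i) //= eqxx (bigD1 (ord_pred (ord_pred i))) //=.
  rewrite (negPf ppi) ifF; last first.
    by have [pp _ _] := ord3_pred (ord_pred i); apply: negbTE.
  by rewrite cardsT; lia.
move=> B /slice_subset botB /slice_subset Btop.
have [botE topE] : bot (slice B i) = bot (slice A i) /\ top (slice B i) = top (slice A i).
  by apply: int; [have := botB i|have := Btop i]; rewrite slice_stack eqxx.
rewrite (@start_some B i) ?botE ?topE //.
  by apply: contraNneq bot0 => Bi0; have := botB i; rewrite slice_stack eqxx Bi0 subset0.
by apply/eqP; have := Btop (ord_pred i); rewrite slice_stack (negPf pi) eqxx subset0.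
Qed.

End Triple.

Lemma interval_partition_exists k :
  exists m (bot top : {set 'I_m} -> {set 'I_m}), (0 < m)%N /\ interval_partition k bot top.
Proof.
have [T [bot [top [T0 part]]]] : exists (T : finType) (bot top : {set T} -> {set T}),
    (0 < #|T|)%N /\ interval_partition k.+1 bot top.
  elim: k => [|k [T [bot [top [T0 part]]]]].
    exists unit, id, id; split=> [|A A0]; first by rewrite card_unit.
    split=> //; first by rewrite card_gt0.
    by move=> B AB BA; have -> : B = A by apply/eqP; rewrite eqEsubset BA AB.
  exists (T * 'I_3)%type, (bot3 bot), (top3 top); split.
    by rewrite card_prod card_ord muln_gt0 T0.
  exact: interval_partition_triple.
pose up (A : {set 'I_#|T|}) := [set t | enum_rank t \in A].
pose dn (A : {set T}) := [set i : 'I_#|T| | enum_val i \in A].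
have upK : cancel up dn by move=> A; apply/setP=> i; rewrite !inE enum_valK.
have dnK : cancel dn up by move=> A; apply/setP=> i; rewrite !inE enum_rankK.
have dn_sub A B : (dn A \subset dn B) = (A \subset B).
  apply/subsetP/subsetP=> AB t; last by rewrite !inE; apply: AB.
  by have := AB (enum_rank t); rewrite !inE enum_rankK.
have dn_card A : #|dn A| = #|A|.
  rewrite -(card_imset (mem A) enum_rank_inj); apply: eq_card => i.
  rewrite inE; apply/idP/imsetP=> [iA|[t tA ->]]; last by rewrite enum_rankK.
  by exists (enum_val i); rewrite ?enum_valK.
have dn0 A : (dn A != set0) = (A != set0) by rewrite -!card_gt0 dn_card.
exists #|T|, (dn \o bot \o up), (dn \o top \o up); split=> // A A0 /=.
have [|bot0 botA Atop ktop int] := part (up A); first by rewrite -dn0 upK.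
split=> [|||| B]; rewrite ?dn0 ?dn_card ?(ltnW ktop) //.
- by rewrite -{2}[A]upK dn_sub.
- by rewrite -{1}[A]upK dn_sub.
by rewrite -[B]upK !dn_sub !dnK => bB Bt; have [-> ->] := int _ bB Bt.
Qed.

End SubsetPartition.

(** * Stanley depth *)

Section SdepthQuot.
Variables (K : fieldType) (n : nat) (I : idealr {mpoly K[n]}).
Hypothesis sI : supported I.
Local Notation S := {mpoly K[n]}.

Lemma sdepth_decomposition_ge t (Z : 'I_t -> {set 'I_n}) k :
  (k <= sdepth_decomposition Z)%N <-> (k <= n)%N /\ forall i, (k <= #|Z i|)%N.
Proof.
have -> : (k <= sdepth_decomposition Z)%N
    = (k <= n)%N && all (fun i => k <= #|Z i|)%N (index_enum 'I_t).
  rewrite /sdepth_decomposition; elim: (index_enum _) => [|i r IHr].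
    by rewrite big_nil andbT.
  by rewrite big_cons leq_min IHr andbCA.
split=> [/andP[-> /allP kZ]|[-> kZ]].
  by split=> // i; apply: kZ; rewrite mem_index_enum.
by apply/allP=> i _.
Qed.

Lemma up_closed_ideal : up_closed (fun b => ('X_[b] : S) \in I).
Proof. by move=> a b; rewrite mpolyXD => /idealMr; apply. Qed.

(** Exponents are cut at a threshold of [I]: coordinates at the threshold
    become free, and the others stay fixed. *)
Lemma cell_decomposition_exists :
  exists t (a : 'I_t -> 'X_{1..n}) Z, cell_decomposition I a Z.
Proof.
have [D ID] := up_closed_truncate up_closed_ideal.
have [|t [a [Z [dec _]]]] := @cell_decomposition_retraction K n I (truncate D)
  (fun b => [set i | (D <= b i)%N]) (n * D).+1; last by exists t, a, Z.
move=> b bI; split.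
- apply/cellP=> i; rewrite inE mnmE; case: ifPn => Db; first by rewrite geq_minl.
  by rewrite eq_sym; apply/eqP/minn_idPl/ltnW; rewrite ltnNge.
- rewrite ltnS mdegE -[n in (n * D)%N]card_ord -sum_nat_const.
  by apply: leq_sum => i _; rewrite mnmE geq_minr.
move=> c /cellP bc.
have trE i : minn (c i) D = minn (b i) D /\ (D <= c i)%N = (D <= b i)%N.
  by have := bc i; rewrite inE mnmE; case: ifPn => [|] ? => [|/eqP]; lia.
have tr : truncate D c = truncate D b.
  by apply/mnmP=> i; rewrite !mnmE; case: (trE i).
split=> //; last by apply/setP=> i; rewrite !inE; case: (trE i).
apply: contra bI => /ID; rewrite tr; apply: ideal_mnm_le.
by apply/mnm_lepP=> i; rewrite mnmE geq_minl.
Qed.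

(** Existence of one cell decomposition makes the maximum defining
    [sdepth_quot] meaningful. *)
Lemma sdepth_quot_geP k : (k <= sdepth_quot I)%N <->
  (k <= n)%N /\ exists t (a : 'I_t -> 'X_{1..n}) Z,
    cell_decomposition I a Z /\ forall i, (k <= #|Z i|)%N.
Proof.
pose P l := exists t (m : 'I_t -> quot_mod I) (Z : 'I_t -> {set 'I_n}),
  stanley_decomposition (@quot_grading K n I) m Z /\ sdepth_decomposition Z = l.
have [||[t [m [Z [dec Zl]]]] maxP] := @max_natP P n.
- have [t [a [Z /(cell_decomposition_stanley sI) dec]]] := cell_decomposition_exists.
  by exists (sdepth_decomposition Z), t, (fun i => quot_pi I 'X_[a i]), Z.
- move=> l [t [m [Z [_ <-]]]].
  by have [] := (sdepth_decomposition_ge Z (sdepth_decomposition Z)).1 (leqnn _).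
split=> [kI|[kn [s [a [Y [Ydec kY]]]]]].
  have [kn kZ] : (k <= n)%N /\ forall i, (k <= #|Z i|)%N.
    by apply/sdepth_decomposition_ge; rewrite Zl.
  have [a adec] := stanley_cell_decomposition sI dec.
  by split=> //; exists t, a, Z.
apply: (@leq_trans (sdepth_decomposition Y)); first exact/sdepth_decomposition_ge.
apply: maxP; exists s, (fun i => quot_pi I 'X_[a i]), Y.
by split=> //; apply: cell_decomposition_stanley.
Qed.

End SdepthQuot.

Section SdepthExtension.
Variables (K : fieldType) (n m : nat) (I : idealr {mpoly K[n]}).
Hypothesis sI : supported I.

Definition xvars (Z : {set 'I_(n + m)}) := [set i | lshift m i \in Z].

Lemma card_xvars (Z : {set 'I_(n + m)}) : (#|Z| <= #|xvars Z| + m)%N.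
Proof.
have : Z \subset (lshift m @: xvars Z) :|: (@rshift n m @: setT).
  apply/subsetP=> i; rewrite -[i]splitK; case: (split i) => j /= jZ; rewrite inE.
    by rewrite imset_f ?inE.
  by rewrite [X in _ || X]imset_f ?orbT ?inE.
move=> /subset_leq_card/leq_trans; apply; apply: leq_trans (leq_card_setU _ _) _.
by rewrite !card_imset ?cardsT ?card_ord //; [exact: rshift_inj|exact: lshift_inj].
Qed.

(** An exponent free of new variables can only lie above such an exponent,
    so cells that start at a new variable contribute nothing to the smaller
    ring. *)
Lemma cell_xpart a Z c :
  cell a Z (xinj m c) = yfree a && cell (xpart a) (xvars Z) c.
Proof.
apply/idP/andP=> [/cellP ac|[/forallP ya /cellP ac]].
  split; first apply/forallP=> j.
    have := ac (rshift n j); rewrite xinj_rshift.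
    by case: ifP => _; rewrite ?leqn0 // eq_sym.
  by apply/cellP=> i; have := ac (lshift m i); rewrite xinj_lshift mnmE inE.
apply/cellP=> i; rewrite -[i]splitK; case: (split i) => j /=.
  by have := ac j; rewrite xinj_lshift mnmE inE.
by rewrite xinj_rshift (eqP (ya j)); case: ifP.
Qed.

(** Cutting each cell down to the old variables loses at most the [m] new
    free variables. *)
Lemma sdepth_ext_le : (sdepth_quot (ext_ideal m I) <= sdepth_quot I + m)%N.
Proof.
rewrite [X in (_ <= X)%N]addnC -leq_subLR; set k := sdepth_quot _.
have [kn [t [a [Z [[cellI cov dis] kZ]]]]] :=
  (sdepth_quot_geP (@ext_ideal_supported K n m I) k).1 (leqnn _).
apply/sdepth_quot_geP => //; split; first by rewrite leq_subLR [X in (_ <= X)%N]addnC.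
pose A := [pred i | yfree (a i)].
exists #|A|, (fun i => xpart (a (enum_val i))), (fun i => xvars (Z (enum_val i))).
have inA (i : 'I_#|A|) c : cell (a (enum_val i)) (Z (enum_val i)) (xinj m c) =
    cell (xpart (a (enum_val i))) (xvars (Z (enum_val i))) c.
  by rewrite cell_xpart; have := enum_valP i; rewrite inE => ->.
split; last first.
  move=> i; rewrite leq_subLR [X in (_ <= X)%N]addnC.
  exact: leq_trans (kZ (enum_val i)) (card_xvars _).
split=> [i c|c cI|i j c].
- by rewrite -inA => /cellI; rewrite ext_ideal_mnm xinjK.
- have [|i ic] := cov (xinj m c); first by rewrite ext_ideal_mnm xinjK.
  have iA : i \in A by move: ic; rewrite cell_xpart => /andP[].
  by exists (enum_rank_in iA i); rewrite -inA enum_rankK_in.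
by rewrite -!inA => ic jc; apply: enum_val_inj; apply: dis ic jc.
Qed.

(** Monomials free of the new variables form one cell. The others have old
    part outside [I]: their old exponents are cut at a threshold of [I], and
    their new exponents follow the interval of their support, with lowest
    exponents 1 on its lower end and free variables on its upper end. *)
Lemma sdepth_ext_cap_ge bot top : @interval_partition 'I_m n bot top ->
  (n <= sdepth_quot (ideal_cap (ext_ideal m I) (new_vars_ideal K n m)))%N.
Proof.
move=> part; set L := ideal_cap _ _.
have sL : supported L.
  by apply: supported_cap; [exact: ext_ideal_supported|exact: new_vars_supported].
have [D ID] := up_closed_truncate (@up_closed_ideal K n I).
pose ysupp (b : 'X_{1..n + m}) := [set j | b (rshift n j) != 0%N].
have yfreeE b : yfree b = (ysupp b == set0).
  apply/forallP/eqP=> [b0|b0 j].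
    by apply/setP=> j; rewrite !inE b0.
  by have := in_set0 j; rewrite -b0 inE => /negbFE.
have LE b : ('X_[b] \in L) = ('X_[xpart b] \in I) && (ysupp b != set0).
  by rewrite [LHS]unfold_in ext_ideal_mnm new_vars_mnm yfreeE.
pose bt b : 'X_{1..n + m} := [multinom (match split i with
  | inl l => if yfree b then 0%N else minn (b (lshift m l)) D
  | inr j => if yfree b then 0%N else nat_of_bool (j \in bot (ysupp b)) end) | i < n + m].
pose tp b := [set i : 'I_(n + m) | match split i with
  | inl l => yfree b || (D <= b (lshift m l))%N
  | inr j => ~~ yfree b && (j \in top (ysupp b)) end].
have btl b l : bt b (lshift m l) = if yfree b then 0%N else minn (b (lshift m l)) D.
  by rewrite mnmE (unsplitK (inl l)).
have btr b j : bt b (rshift n j) =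
    if yfree b then 0%N else nat_of_bool (j \in bot (ysupp b)).
  by rewrite mnmE (unsplitK (inr j)).
have tpl b l : (lshift m l \in tp b) = yfree b || (D <= b (lshift m l))%N.
  by rewrite inE (unsplitK (inl l)).
have tpr b j : (rshift n j \in tp b) = ~~ yfree b && (j \in top (ysupp b)).
  by rewrite inE (unsplitK (inr j)).
have cell2P b c : cell (bt b) (tp b) c <->
    (forall l, if lshift m l \in tp b then (bt b (lshift m l) <= c (lshift m l))%N
               else c (lshift m l) == bt b (lshift m l)) /\
    (forall j, if rshift n j \in tp b then (bt b (rshift n j) <= c (rshift n j))%N
               else c (rshift n j) == bt b (rshift n j)).
  split=> [/cellP bc|[bcl bcr]]; first by split=> l; apply: bc.
  by apply/cellP=> i; rewrite -[i]splitK; case: (split i) => l; [apply: bcl|apply: bcr].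
have [|t [a [Z [dec Ztp]]]] := @cell_decomposition_retraction K _ L bt tp
    ((n + m) * D.+1).+1; last first.
  apply/sdepth_quot_geP => //; split; first exact: leq_addr.
  exists t, a, Z; split=> // i; have [b _ ->] := Ztp i.
  have [yb|yb] := boolP (yfree b).
    rewrite -[X in (X <= _)%N]card_ord -cardsT -(card_imset setT (@lshift_inj n m)).
    apply: subset_leq_card; apply/subsetP=> _ /imsetP[l _ ->].
    by rewrite tpl yb.
  have [|_ _ _ + _] := part (ysupp b); first by rewrite -yfreeE.
  move=> /leq_trans; apply; rewrite -(card_imset _ (@rshift_inj n m)).
  apply: subset_leq_card; apply/subsetP=> _ /imsetP[j jt ->].
  by rewrite tpr yb.
move=> b bL; have btD i : (bt b i <= D.+1)%N.
  rewrite -[i]splitK; case: (split i) => l /=; rewrite ?btl ?btr; case: ifP => // _.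
    by rewrite (leq_trans (geq_minr _ _)).
  by case: (_ \in _).
have dbt : (mdeg (bt b) < ((n + m) * D.+1).+1)%N.
  rewrite ltnS mdegE -[X in (X * _)%N]card_ord -sum_nat_const.
  by apply: leq_sum => i _.
have [yb|yb] := boolP (yfree b).
  split=> // [|c /cell2P[_ bc]].
    apply/cell2P; split=> l; rewrite ?tpl ?tpr ?btl ?btr yb //=.
    by move: yb => /forallP/(_ l)/eqP->.
  have yc : yfree c.
    by apply/forallP=> j; have := bc j; rewrite tpr btr yb.
  split; first by rewrite LE -yfreeE yc andbF.
    apply: mnm_ext => [|j]; last by rewrite !btr yb yc.
    by apply/mnmP=> l; rewrite !(mnmE _ l) !btl yb yc.
  by apply/setP=> i; rewrite -[i]splitK; case: (split i) => l /=; rewrite ?tpl ?tpr yb yc.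
have [|bot0 botb btop _ int] := part (ysupp b); first by rewrite -yfreeE.
have xbI : 'X_[xpart b] \notin I by move: bL; rewrite LE -yfreeE yb andbT.
split=> // [|c /cell2P[bcl bcr]].
  apply/cell2P; split=> l; rewrite ?tpl ?tpr ?btl ?btr (negPf yb) /=.
    case: ifPn => Db; first by rewrite geq_minl.
    by rewrite eq_sym; apply/eqP/minn_idPl/ltnW; rewrite ltnNge.
  case: ifPn => lt.
    by case: (boolP (l \in bot _)) => // /(subsetP botb); rewrite inE lt0n.
  have : l \notin ysupp b by apply: contra lt; apply: (subsetP btop).
  rewrite inE negbK => /eqP b0; rewrite b0 eq_sym eqb0; apply: contra lt.
  by move=> /(subsetP botb)/(subsetP btop).
have bot_c : bot (ysupp b) \subset ysupp c.
  apply/subsetP=> j jb; have := bcr j; rewrite tpr btr (negPf yb) jb inE /=.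
  by rewrite (subsetP btop) ?(subsetP botb) // lt0n.
have c_top : ysupp c \subset top (ysupp b).
  apply/subsetP=> j; rewrite inE; apply: contraNT => jt.
  have := bcr j; rewrite tpr btr (negPf yb) /= (negPf jt) => /eqP->.
  by rewrite eqb0; apply: contra jt => /(subsetP botb)/(subsetP btop).
have [botE topE] := int _ bot_c c_top.
have yc : ~~ yfree c.
  rewrite yfreeE; apply: contraNneq bot0 => c0.
  by rewrite -subset0 -c0.
have trE l : minn (c (lshift m l)) D = minn (b (lshift m l)) D /\
    (D <= c (lshift m l))%N = (D <= b (lshift m l))%N.
  have := bcl l; rewrite tpl btl (negPf yb) /=.
  by case: ifPn => [|] ? => [|/eqP]; lia.
split.
- rewrite LE negb_and; apply/orP; left; apply: contra xbI => /ID.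
  have -> : truncate D (xpart c) = truncate D (xpart b).
    by apply/mnmP=> l; rewrite !mnmE; case: (trE l).
  by apply: ideal_mnm_le; apply/mnm_lepP=> l; rewrite mnmE geq_minl.
- apply: mnm_ext => [|j]; last by rewrite !btr (negPf yb) (negPf yc) botE.
  apply/mnmP=> l; rewrite !(mnmE _ l) !btl (negPf yb) (negPf yc).
  by case: (trE l).
apply/setP=> i; rewrite -[i]splitK; case: (split i) => l /=.
  by rewrite !tpl (negPf yb) (negPf yc) /=; case: (trE l).
by rewrite !tpr yb yc topE.
Qed.

End SdepthExtension.

Theorem proposition3p4 (K : fieldType) :
  let assertion1 :=
    forall (n : nat) (I : idealr {mpoly K[n]}), (0 < n)%N ->
      monomial_ideal I -> nonzero_ideal I ->
      (depth_quot I <= sdepth_quot I)%N in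
  let assertion2 :=
    forall (n : nat) (I J : idealr {mpoly K[n]}), (0 < n)%N ->
      monomial_ideal I -> nonzero_ideal I ->
      monomial_ideal J -> nonzero_ideal J ->
      (depth_quot (ideal_cap I J) <= sdepth_quot (ideal_cap I J))%N ->
      (depth_quot I <= sdepth_quot I)%N in
  let assertion3 :=
    forall (n m : nat) (I : idealr {mpoly K[n]}), (0 < n)%N -> (0 < m)%N ->
      monomial_ideal I -> nonzero_ideal I ->
      forall u : m.-tuple {mpoly K[n]},
      (forall i : 'I_m, is_monomial (tnth u i)) ->
      regular_seq (quot_mod I) u ->
      forall J : idealr {mpoly K[n]},
      (forall f, f \in J <-> ideal_gen (fun v => v \in tval u) f) ->
      (depth_quot (ideal_cap I J) <= sdepth_quot (ideal_cap I J))%N ->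
      (depth_quot I <= sdepth_quot I)%N in
  (assertion1 <-> assertion2) /\ (assertion2 <-> assertion3).
Proof.
move=> assertion1 assertion2 assertion3.
have a12 : assertion1 -> assertion2 by move=> a1 n I J n0 mI zI _ _ _; apply: a1.
have a23 : assertion2 -> assertion3.
  move=> a2 n m I n0 m0 mI zI u umon _ J Jgen; apply: a2 => //.
    exists (fun v => v \in tval u); split=> // v /tnthP[i ->]; exact: umon.
  exists (tnth u (Ordinal m0)).
    by apply/Jgen/ideal_gen_sub/mem_tnth.
  by have [a ->] := umon (Ordinal m0); rewrite -msize_poly_eq0 msizeX.
have a31 : assertion3 -> assertion1.
  move=> a3 n I n0 /monomial_supported sI zI.
  have [m [bot [top [m0 part]]]] := interval_partition_exists n.
  rewrite -(leq_add2r m); apply: leq_trans (depth_ext_ge m sI) _.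
  apply: leq_trans (sdepth_ext_le m sI).
  apply: (a3 _ m _ _ m0 _ _ (new_vars K n m) _ _ (new_vars_ideal K n m)).
  - by rewrite addn_gt0 n0.
  - exact/supported_monomial/ext_ideal_supported.
  - have [f fI f0] := zI; exists (iota_vars m f); first exact: iota_ext.
    by apply: contraNneq f0 => f0; rewrite -(iotaK m f) f0 rmorph0.
  - by move=> j; rewrite tnth_mktuple; exists U_(rshift n j)%MM.
  - exact: regular_new_vars.
  - exact: new_vars_ideal_gen.
  apply: leq_trans (depth_ext_cap_le m sI zI) _.
  exact: sdepth_ext_cap_ge part.
by split; split=> //; [move/a23/a31|move/a31/a12].
Qed.
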